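(* Let $H_0$ and $H_1^1,\dots,H_1^\Gamma$ be Hermitian operators on a finite-dimensional Hilbert space, let $\alpha\in\mathbb{R}$, let $H_1=\sum_{\gamma=1}^\Gamma H_1^\gamma$ and $H=H_0+\alpha H_1$. For $t\ge 0$ define $$U_{\rm apx}(t):=e^{-itH_0}\prod_{\gamma=1}^{\Gamma}\left(e^{itH_0}e^{-it(H_0+\alpha H_1^\gamma)}\right),$$ where the product is ordered with the factor $\gamma=1$ leftmost. Then $U_{\rm apx}(t)$ approximates $U(t)=e^{-itH}$ with error $$\|U(t)-U_{\rm apx}(t)\|\leq \alpha^2\int_{0}^{t}dv\int_{0}^{v}ds\sum_{1\le\gamma_1<\gamma_2\le\Gamma}\|[H_{1}^{\gamma_1}(s),H_{1}^{\gamma_2}(v)]\|,$$ where $H_1^\gamma(s):=e^{isH_0}H_1^\gamma e^{-isH_0}$. In particular, for sufficiently small time $t$ this error is $O(\alpha^2t^2)$.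
   Context: $\|\cdot\|$ denotes the operator (spectral) norm. *)

(* Defs.v *)
From HB Require Import structures.
From mathcomp Require Import all_boot all_order all_algebra.
From mathcomp Require Import all_classical all_reals all_analysis.
From mathcomp Require Import complex.
Set Implicit Arguments. Unset Strict Implicit. Unset Printing Implicit Defensive.
Import Order.TTheory GRing.Theory Num.Theory.
Import numFieldNormedType.Exports.
Local Open Scope ring_scope.
Local Open Scope complex_scope.
Local Open Scope classical_set_scope.

(* Operators on the n-dimensional Hilbert space C^n are n x n matrices over
   the complex numbers R[i], R a real type. *)

Definition mexp (R : realType) (n : nat) (A : 'M[R[i]]_n) : 'M[R[i]]_n :=
  limn (fun N : nat => \sum_(k < N) (k`!%:R)^-1 *: A ^+ k).

Definition is_hermitian (R : realType) (n : nat) (A : 'M[R[i]]_n) : Prop :=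
  map_mx (@conjc R) A^T = A.

Definition vnorm (R : realType) (n : nat) (v : 'cV[R[i]]_n) : R :=
  Num.sqrt (\sum_(j < n) ComplexField.Normc.normc (v j 0) ^+ 2).

Definition spec_norm (R : realType) (n : nat) (A : 'M[R[i]]_n) : R :=
  sup [set vnorm (A *m v) | v in [set v : 'cV[R[i]]_n | vnorm v = 1]].

Definition comm (R : realType) (n : nat) (A B : 'M[R[i]]_n) : 'M[R[i]]_n :=
  A *m B - B *m A.

Definition evol (R : realType) (n : nat) (t : R) (H : 'M[R[i]]_n) : 'M[R[i]]_n :=
  mexp (- ('i * t%:C) *: H).

Definition heis (R : realType) (n : nat) (H0 H : 'M[R[i]]_n) (s : R) : 'M[R[i]]_n :=
  evol (- s) H0 *m H *m evol s H0.

(* U_apx(t) = e^{-itH0} prod_{gamma = 1..Gamma} (e^{itH0} e^{-it(H0 + alpha H1^gamma)}),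
   the factor with index 0 (gamma = 1) leftmost. *)
Definition Uapx (R : realType) (n Gamma : nat) (H0 : 'M[R[i]]_n)
    (H1 : 'I_Gamma -> 'M[R[i]]_n) (alpha t : R) : 'M[R[i]]_n :=
  evol t H0 *m \prod_(g < Gamma) (evol (- t) H0 *m evol t (H0 + alpha%:C *: H1 g)).

Definition Uexact (R : realType) (n Gamma : nat) (H0 : 'M[R[i]]_n)
    (H1 : 'I_Gamma -> 'M[R[i]]_n) (alpha t : R) : 'M[R[i]]_n :=
  evol t (H0 + alpha%:C *: \sum_(g < Gamma) H1 g).

Definition comm_sum (R : realType) (n Gamma : nat) (H0 : 'M[R[i]]_n)
    (H1 : 'I_Gamma -> 'M[R[i]]_n) (s v : R) : R :=
  \sum_(g1 < Gamma) \sum_(g2 < Gamma | (g1 < g2)%N)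
     spec_norm (comm (heis H0 (H1 g1) s) (heis H0 (H1 g2) v)).

Definition err_bound_integral (R : realType) (n Gamma : nat) (H0 : 'M[R[i]]_n)
    (H1 : 'I_Gamma -> 'M[R[i]]_n) (t : R) : R :=
  Rintegral (@lebesgue_measure R) `[0, t]
    (fun v => Rintegral (@lebesgue_measure R) `[0, v] (fun s => comm_sum H0 H1 s v)).

(* Main.v *)
(** Write [B(s)] for the Heisenberg picture [e^{isH0} B e^{-isH0}] and
    [A_B(t) = e^{itH0} e^{-it(H0 + alpha B)}].  Everything rests on the factorisation
    [A_B(s + h) = Q A_B(s)] with [Q = 1 - i h alpha B(s) + O(h^2)] unitary and the error
    uniform in [s].  It shows first that [||[A_B(t), X]||] grows at rate at most
    [|alpha| ||[B(t), X]||], and then that [||A_{B+C}(t) - A_B(t) A_C(t)||] grows at rate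
    at most [|alpha| ||[A_B(t), C(t)]||], because [Q_{B+C} A_B - Q_B A_B Q_C] is
    [i h alpha [A_B, C(t)] + O(h^2)].  Hence splitting off one summand costs at most
    [alpha^2] times the double integral of [||[B(s), C(v)]||]; induction on the number of
    summands, with [B] the sum of all but the last one, gives the theorem.
    Growth rates with [O(h^2)] errors replace derivatives: they are integrated by
    subdividing the time interval, which only needs the rate to be Lipschitz. *)

Require Import Defs.
From HB Require Import structures.
From mathcomp Require Import all_boot all_order all_algebra.
From mathcomp Require Import all_classical all_reals all_analysis.
From mathcomp Require Import complex ring lra.
Import Order.TTheory GRing.Theory Num.Theory.
Import numFieldNormedType.Exports.
Import ComplexField.Normc.
Set Implicit Arguments. Unset Strict Implicit. Unset Printing Implicit Defensive.
Local Open Scope ring_scope.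

(** * The spectral norm *)

(** With [a] and [b] the two norms, the squares of [f i * b - g i * a] sum to [2ab(ab - S)], which
    is therefore nonnegative. The last step divides by [ab], so a vanishing norm is treated apart:
    it forces all its terms to vanish. *)
Lemma cauchy_schwarz_sum (R : rcfType) (I : finType) (f g : I -> R) :
  \sum_i f i * g i <=
    Num.sqrt (\sum_i f i ^+ 2) * Num.sqrt (\sum_i g i ^+ 2).
Proof.
have F0 : 0 <= \sum_i f i ^+ 2 by apply: sumr_ge0 => i _; exact: sqr_ge0.
have G0 : 0 <= \sum_i g i ^+ 2 by apply: sumr_ge0 => i _; exact: sqr_ge0.
set a := Num.sqrt _; set b := Num.sqrt _.
have a2 : a ^+ 2 = \sum_i f i ^+ 2 by rewrite sqr_sqrtr.
have b2 : b ^+ 2 = \sum_i g i ^+ 2 by rewrite sqr_sqrtr.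
have a0 : 0 <= a := sqrtr_ge0 _.
have b0 : 0 <= b := sqrtr_ge0 _.
have [az|az] := eqVneq a 0.
  move: a2; rewrite az mul0r expr0n/= => /esym/eqP.
  rewrite psumr_eq0 => [/allP f0|i _]; last exact: sqr_ge0.
  rewrite big1// => i _; have := f0 i (mem_index_enum i).
  by rewrite /= sqrf_eq0 => /eqP ->; rewrite mul0r.
have [bz|bz] := eqVneq b 0.
  move: b2; rewrite bz mulr0 expr0n/= => /esym/eqP.
  rewrite psumr_eq0 => [/allP g0|i _]; last exact: sqr_ge0.
  rewrite big1// => i _; have := g0 i (mem_index_enum i).
  by rewrite /= sqrf_eq0 => /eqP ->; rewrite mulr0.
have : 0 <= \sum_i (f i * b - g i * a) ^+ 2.
  by apply: sumr_ge0 => i _; exact: sqr_ge0.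
have expand i : (f i * b - g i * a) ^+ 2 =
    b ^+ 2 * f i ^+ 2 - 2 * (a * b) * (f i * g i) + a ^+ 2 * g i ^+ 2 by ring.
under eq_bigr do rewrite expand.
rewrite big_split sumrB/= -!mulr_sumr -a2 -b2; set S := \sum_i _ => h.
have : 0 <= 2 * (a * b) * (a * b - S).
  by apply: (le_trans h); rewrite le_eqVlt; apply/orP; left; apply/eqP; ring.
by rewrite pmulr_rge0 ?subr_ge0// mulr_gt0// mulr_gt0// lt0r ?az ?bz.
Qed.

Lemma normc_ge0 (R : rcfType) (z : R[i]) : 0 <= normc z.
Proof. by case: z => a b; exact: sqrtr_ge0. Qed.

Section vnorm_theory.
Context {R : realType}.

Lemma vnorm_ge0 n (v : 'cV[R[i]]_n) : 0 <= vnorm v.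
Proof. exact: sqrtr_ge0. Qed.

Lemma vnorm_sqr n (v : 'cV[R[i]]_n) : vnorm v ^+ 2 = \sum_i normc (v i 0) ^+ 2.
Proof. by rewrite sqr_sqrtr// sumr_ge0// => i _; exact: sqr_ge0. Qed.

Lemma vnorm0 n : vnorm (0 : 'cV[R[i]]_n) = 0.
Proof.
rewrite /vnorm big1 ?sqrtr0// => i _.
by rewrite mxE normc0 expr0n.
Qed.

Lemma vnorm_eq0 n (v : 'cV[R[i]]_n) : vnorm v = 0 -> v = 0.
Proof.
move=> v0; have := vnorm_sqr v; rewrite v0 expr0n/= => /esym/eqP.
rewrite psumr_eq0 => [/allP h|i _]; last exact: sqr_ge0.
apply/matrixP => i j; rewrite ord1 mxE; have := h i (mem_index_enum i).
by rewrite /= sqrf_eq0 => /eqP/eq0_normc.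
Qed.

Lemma vnormD n (u v : 'cV[R[i]]_n) : vnorm (u + v) <= vnorm u + vnorm v.
Proof.
rewrite -(ler_pXn2r (ltn0Sn 1)) ?nnegrE ?addr_ge0 ?vnorm_ge0//.
rewrite sqrrD !vnorm_sqr.
have cs := cauchy_schwarz_sum (fun i => normc (u i 0)) (fun i => normc (v i 0)).
apply: (@le_trans _ _ (\sum_i (normc (u i 0) + normc (v i 0)) ^+ 2)).
  apply: ler_sum => i _; rewrite mxE ler_pXn2r ?nnegrE ?addr_ge0 ?normc_ge0//.
  exact: le_normcD.
under eq_bigr do rewrite sqrrD.
by rewrite !big_split/= lerD2r lerD2l mulr2n lerD.
Qed.

Lemma vnormZ n c (v : 'cV[R[i]]_n) : vnorm (c *: v) = normc c * vnorm v.
Proof.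
rewrite {1}/vnorm; under eq_bigr do rewrite mxE normcM exprMn.
by rewrite -mulr_sumr sqrtrM ?sqr_ge0// sqrtr_sqr ger0_norm ?normc_ge0.
Qed.

Lemma normc_le_vnorm n (v : 'cV[R[i]]_n) i : normc (v i 0) <= vnorm v.
Proof.
rewrite -(ler_pXn2r (ltn0Sn 1)) ?nnegrE ?vnorm_ge0 ?normc_ge0// vnorm_sqr.
by rewrite (bigD1 i)//= lerDl sumr_ge0// => j _; exact: sqr_ge0.
Qed.

Lemma ler_normc_sum (I : finType) (F : I -> R[i]) :
  normc (\sum_i F i) <= \sum_i normc (F i).
Proof.
elim/big_rec2: _ => [|i y x _ h]; first by rewrite normc0.
by rewrite (le_trans (le_normcD _ _))// lerD2l.
Qed.

Lemma vnorm_le_sum n (v : 'cV[R[i]]_n) : vnorm v <= \sum_i normc (v i 0).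
Proof.
have S0 : 0 <= \sum_i normc (v i 0) by apply: sumr_ge0 => i _; exact: normc_ge0.
rewrite -(ler_pXn2r (ltn0Sn 1)) ?nnegrE ?vnorm_ge0// vnorm_sqr expr2 mulr_suml.
apply: ler_sum => i _; rewrite expr2 ler_wpM2l ?normc_ge0//.
by rewrite (bigD1 i)//= lerDl sumr_ge0// => j _; exact: normc_ge0.
Qed.

(** A crude bound whose purpose is to show that the set whose supremum defines [spec_norm] is
    bounded above, without which [sup] would carry no information. *)
Lemma vnorm_mulmx_le n (A : 'M[R[i]]_n) (v : 'cV[R[i]]_n) :
  vnorm (A *m v) <= (\sum_i \sum_j normc (A i j)) * vnorm v.
Proof.
apply: (le_trans (vnorm_le_sum _)); rewrite mulr_suml; apply: ler_sum => i _.
rewrite mxE (le_trans (ler_normc_sum _))// mulr_suml; apply: ler_sum => j _.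
by rewrite normcM ler_wpM2l ?normc_ge0 ?normc_le_vnorm.
Qed.

Lemma vnorm_delta n (j : 'I_n) : vnorm (delta_mx j 0 : 'cV[R[i]]_n) = 1.
Proof.
apply: (@pexpIrn _ 2); rewrite ?nnegrE ?vnorm_ge0//.
rewrite vnorm_sqr (bigD1 j)//= big1 => [|i /negPf ij].
  by rewrite mxE !eqxx normc1 !expr1n addr0.
by rewrite mxE ij normc0 expr0n.
Qed.

End vnorm_theory.

(** * The spectral norm as an operator norm *)

Section spec_norm_theory.
Context {R : realType}.
Local Open Scope classical_set_scope.

Let image_set n (A : 'M[R[i]]_n) : set R :=
  [set vnorm (A *m v) | v in [set v : 'cV[R[i]]_n | vnorm v = 1]].

Lemma spec_norm_ge0 n (A : 'M[R[i]]_n) : 0 <= spec_norm A.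
Proof.
have [[x Sx]|/nonemptyPn S0] := pselect (image_set A !=set0).
  apply: (@le_trans _ _ x); first by case: Sx => v _ <-; exact: vnorm_ge0.
  apply: ub_le_sup => //; exists (\sum_i \sum_j normc (A i j)) => _ [v v1 <-].
  by rewrite (le_trans (vnorm_mulmx_le _ _))// v1 mulr1.
by rewrite /spec_norm -/(image_set A) S0 sup0.
Qed.

(** Rescaling a nonzero [v] to norm 1 makes it a competitor in the supremum. *)
Lemma vnorm_mulmx n (A : 'M[R[i]]_n) v :
  vnorm (A *m v) <= spec_norm A * vnorm v.
Proof.
have [v0|v0] := eqVneq (vnorm v) 0.
  by rewrite (vnorm_eq0 v0) mulmx0 vnorm0 mulr0.
have vp : 0 < vnorm v by rewrite lt0r v0 vnorm_ge0.
pose c : R[i] := (vnorm v)^-1%:C%C.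
have nc : normc c = (vnorm v)^-1.
  by rewrite /= expr0n/= addr0 sqrtr_sqr ger0_norm// invr_ge0 ltW.
have : vnorm (A *m (c *: v)) <= spec_norm A.
  apply: ub_le_sup; last by exists (c *: v) => //=; rewrite vnormZ nc mulVf.
  exists (\sum_i \sum_j normc (A i j)) => _ [w w1 <-].
  by rewrite (le_trans (vnorm_mulmx_le _ _))// w1 mulr1.
by rewrite -scalemxAr vnormZ nc mulrC ler_pdivrMr.
Qed.

(** The sign condition on [c] serves dimension 0: there is no unit vector there, and [sup] of the
    empty set is 0. *)
Lemma spec_norm_le n (A : 'M[R[i]]_n) (c : R) : 0 <= c ->
  (forall v, vnorm (A *m v) <= c * vnorm v) -> spec_norm A <= c.
Proof.
move=> c0 h; have [S0|/nonemptyPn S0] := pselect (image_set A !=set0).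
  by apply: ge_sup => // _ [v v1 <-]; rewrite (le_trans (h v))// v1 mulr1.
by rewrite /spec_norm -/(image_set A) S0 sup0.
Qed.

Lemma spec_norm0 n : spec_norm (0 : 'M[R[i]]_n) = 0.
Proof.
apply/eqP; rewrite eq_le spec_norm_ge0 andbT.
by apply: spec_norm_le => // v; rewrite mul0mx vnorm0 mul0r.
Qed.

Lemma spec_norm1 n : spec_norm (1%:M : 'M[R[i]]_n) <= 1.
Proof. by apply: spec_norm_le => // v; rewrite mul1mx mul1r. Qed.

Lemma spec_normD n (A B : 'M[R[i]]_n) :
  spec_norm (A + B) <= spec_norm A + spec_norm B.
Proof.
apply: spec_norm_le => [|v]; first by rewrite addr_ge0 ?spec_norm_ge0.
by rewrite mulmxDl mulrDl (le_trans (vnormD _ _))// lerD ?vnorm_mulmx.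
Qed.

Lemma spec_normM n (A B : 'M[R[i]]_n) :
  spec_norm (A *m B) <= spec_norm A * spec_norm B.
Proof.
apply: spec_norm_le => [|v]; first by rewrite mulr_ge0 ?spec_norm_ge0.
rewrite -mulmxA -mulrA (le_trans (vnorm_mulmx _ _))//.
by rewrite ler_wpM2l ?spec_norm_ge0 ?vnorm_mulmx.
Qed.

Lemma spec_normZ n c (A : 'M[R[i]]_n) :
  spec_norm (c *: A) <= normc c * spec_norm A.
Proof.
apply: spec_norm_le => [|v]; first by rewrite mulr_ge0 ?spec_norm_ge0 ?normc_ge0.
by rewrite -scalemxAl vnormZ -mulrA ler_wpM2l ?normc_ge0 ?vnorm_mulmx.
Qed.

Lemma spec_normN n (A : 'M[R[i]]_n) : spec_norm (- A) = spec_norm A.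
Proof.
have h B : spec_norm (- B : 'M[R[i]]_n) <= spec_norm B.
  by rewrite -scaleN1r (le_trans (spec_normZ _ _))// normcN normc1 mul1r.
apply/eqP; rewrite eq_le h /= -{1}[A]opprK; exact: h.
Qed.

Lemma spec_normB n (A B : 'M[R[i]]_n) :
  spec_norm (A - B) <= spec_norm A + spec_norm B.
Proof. by rewrite -(spec_normN B) spec_normD. Qed.

Lemma spec_normBC n (A B : 'M[R[i]]_n) : spec_norm (A - B) = spec_norm (B - A).
Proof. by rewrite -spec_normN opprB. Qed.

Lemma spec_norm_triangle n (B A C : 'M[R[i]]_n) :
  spec_norm (A - C) <= spec_norm (A - B) + spec_norm (B - C).
Proof. by rewrite -[A](subrK B) -addrA [A - B + _ - _]addrK spec_normD. Qed.

Lemma spec_norm_dist n (A B : 'M[R[i]]_n) :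
  `|spec_norm A - spec_norm B| <= spec_norm (A - B).
Proof.
have h (X Y : 'M[R[i]]_n) : spec_norm X - spec_norm Y <= spec_norm (X - Y).
  by rewrite lerBlDr -{1}[X](subrK Y) spec_normD.
rewrite ler_norml; apply/andP; split; last exact: h.
by rewrite lerNl opprB spec_normBC; exact: h.
Qed.

Lemma spec_norm_sum n (I : Type) (r : seq I) (P : pred I) (F : I -> 'M[R[i]]_n) :
  spec_norm (\sum_(i <- r | P i) F i) <= \sum_(i <- r | P i) spec_norm (F i).
Proof.
elim/big_rec2: _ => [|i y x _ h]; first by rewrite spec_norm0.
by rewrite (le_trans (spec_normD _ _))// lerD2l.
Qed.

Lemma spec_normX n (A : 'M[R[i]]_n) k : spec_norm (A ^+ k) <= spec_norm A ^+ k.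
Proof.
elim: k => [|k ih]; first by rewrite !expr0; exact: spec_norm1.
rewrite !exprS (le_trans (spec_normM _ _))//.
by rewrite ler_wpM2l ?spec_norm_ge0.
Qed.

(** [A] maps the [j]-th basis vector to its [j]-th column. With [spec_norm_le_sum], this makes the
    spectral norm comparable to the entries, so limits can be taken entry by entry. *)
Lemma normc_le_spec_norm n (A : 'M[R[i]]_n) i j : normc (A i j) <= spec_norm A.
Proof.
have := vnorm_mulmx A (delta_mx j 0); rewrite vnorm_delta mulr1.
apply: le_trans; rewrite (le_trans _ (normc_le_vnorm _ i))//.
by rewrite -colE mxE.
Qed.

Lemma spec_norm_le_sum n (A : 'M[R[i]]_n) :
  spec_norm A <= \sum_i \sum_j normc (A i j).
Proof.
apply: spec_norm_le => [|v]; last exact: vnorm_mulmx_le.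
by do 2 (apply: sumr_ge0 => ? _); exact: normc_ge0.
Qed.

Lemma spec_norm_eq0 n (A : 'M[R[i]]_n) : spec_norm A <= 0 -> A = 0.
Proof.
move=> A0; apply/matrixP => i j; rewrite mxE; apply: eq0_normc; apply/eqP.
by rewrite eq_le normc_ge0 andbT (le_trans (normc_le_spec_norm _ _ _)).
Qed.

End spec_norm_theory.

(** * The matrix exponential *)

Definition exp_sum (R : realType) (n : nat) (A : 'M[R[i]]_n) (N : nat) :=
  \sum_(k < N) (k`!%:R)^-1 *: A ^+ k.

Section exp_partial_sums.
Context {R : realType}.
Local Open Scope classical_set_scope.

Lemma normc_nat k : normc (k%:R : R[i]) = k%:R.
Proof. by rewrite normcMn normc1. Qed.

Lemma normc_real (x : R) : normc (x%:C)%C = `|x|.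
Proof. by rewrite /= expr0n addr0 sqrtr_sqr. Qed.

Lemma normc_imaginary : normc ('i : R[i]) = 1.
Proof.
have h : normc ('i : R[i]) ^+ 2 = 1.
  by rewrite expr2 -normcM -expr2 sqrCi normcN normc1.
by apply: (@pexpIrn _ 2); rewrite ?nnegrE ?normc_ge0// h expr1n.
Qed.

Lemma normc_le_ReIm (z : R[i]) : normc z <= `|complex.Re z| + `|complex.Im z|.
Proof.
case: z => a b /=; rewrite -[leRHS]ger0_norm ?addr_ge0// -sqrtr_sqr ler_wsqrtr//.
by rewrite sqrrD !real_normK ?num_real// -addrA lerD2l lerDr mulrn_wge0// mulr_ge0.
Qed.

Lemma norm_Re_le (z : R[i]) : `|complex.Re z| <= normc z.
Proof. by case: z => a b /=; rewrite -sqrtr_sqr ler_wsqrtr// lerDl sqr_ge0. Qed.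

Lemma norm_Im_le (z : R[i]) : `|complex.Im z| <= normc z.
Proof. by case: z => a b /=; rewrite -sqrtr_sqr ler_wsqrtr// lerDr sqr_ge0. Qed.

Lemma series_exp_coeff_le (a : R) N : 0 <= a -> series (exp_coeff a) N <= expR a.
Proof.
move=> a0; apply: nondecreasing_cvgn_le; last exact: is_cvg_series_exp_coeff.
by apply: nondecreasing_series => k _ _; exact: exp_coeff_ge0.
Qed.

Lemma spec_norm_exp_term n (A : 'M[R[i]]_n) k :
  spec_norm ((k`!%:R)^-1 *: A ^+ k) <= exp_coeff (spec_norm A) k.
Proof.
rewrite (le_trans (spec_normZ _ _))// normcV normc_nat /exp_coeff mulrC.
by rewrite ler_wpM2r ?invr_ge0// spec_normX.
Qed.

Lemma spec_norm_exp_sum n (A : 'M[R[i]]_n) N :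
  spec_norm (exp_sum A N) <= expR (spec_norm A).
Proof.
rewrite (le_trans (spec_norm_sum _ _ _))//.
apply: le_trans (series_exp_coeff_le N (spec_norm_ge0 A)).
by rewrite /series/= big_mkord ler_sum// => k _; exact: spec_norm_exp_term.
Qed.

Lemma cvgn_sum0 (I : finType) (u : I -> R^nat) :
  (forall i, u i @ \oo --> (0 : R)) ->
  \sum_i u i N @[N --> \oo] --> (0 : R).
Proof.
move=> u0; elim: (index_enum I) => [|i r ih].
  rewrite (_ : (fun _ => _) = cst 0); first exact: cvg_cst.
  by apply/funext => N; rewrite big_nil.
rewrite (_ : (fun _ => _) = u i \+ (fun N => \sum_(j <- r) u j N)).
  by have := cvgD (u0 i) ih; rewrite addr0; apply.
by apply/funext => N; rewrite big_cons.
Qed.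

Let term n (A : 'M[R[i]]_n) i j k : R[i] := ((k`!%:R)^-1 *: A ^+ k) i j.

(** Meant for [f] the real or the imaginary part. The terms are dominated by the exponential series
    of [spec_norm A], so the real series converges absolutely. *)
Let is_cvg_term n (A : 'M[R[i]]_n) i j (f : R[i] -> R) :
  (forall z, `|f z| <= normc z) -> cvgn (series (fun k => f (term A i j k))).
Proof.
move=> fle; apply: normed_cvg.
apply: (@series_le_cvg _ _ (exp_coeff (spec_norm A))) => [k|k|k|].
- exact: normr_ge0.
- exact/exp_coeff_ge0/spec_norm_ge0.
- apply: (le_trans (fle _)); apply: le_trans (spec_norm_exp_term A k).
  exact: normc_le_spec_norm.
- exact: is_cvg_series_exp_coeff.
Qed.

Let L n (A : 'M[R[i]]_n) : 'M[R[i]]_n := \matrix_(i, j)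
  Complex (limn (series (fun k => complex.Re (term A i j k))))
          (limn (series (fun k => complex.Im (term A i j k)))).

(** The error is at most the sum, over all entries, of the errors of the real and imaginary parts:
    finitely many null sequences. *)
Let exp_sum_cvgL n (A : 'M[R[i]]_n) :
  spec_norm (exp_sum A N - L A) @[N --> \oo] --> (0 : R).
Proof.
pose d (f : R[i] -> R) i j N :=
  series (fun k => f (term A i j k)) N - limn (series (fun k => f (term A i j k))).
have d0 (f : R[i] -> R) i j : (forall z, `|f z| <= normc z) ->
    `|d f i j N| @[N --> \oo] --> (0 : R).
  move=> fle; rewrite -(normr0 R); apply: cvg_norm.
  rewrite -(subrr (limn (series (fun k => f (term A i j k))))).
  by apply: cvgB; [exact: is_cvg_term|exact: cvg_cst].
have s0 : \sum_i \sum_j (`|d (@complex.Re R) i j N| + `|d (@complex.Im R) i j N|)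
    @[N --> \oo] --> (0 : R).
  apply: cvgn_sum0 => i; apply: cvgn_sum0 => j.
  have := cvgD (d0 _ i j norm_Re_le) (d0 _ i j norm_Im_le).
  by rewrite addr0; apply.
have ReD : {morph @complex.Re R : x y / x + y} by case=> ? ? [].
have ImD : {morph @complex.Im R : x y / x + y} by case=> ? ? [].
apply: squeeze_cvgr s0; last exact: cvg_cst.
apply: nearW => N; rewrite spec_norm_ge0/=.
rewrite (le_trans (spec_norm_le_sum _))//; apply: ler_sum => i _; apply: ler_sum => j _.
apply: (le_trans (normc_le_ReIm _)).
rewrite !mxE summxE ReD ImD /= (big_morph _ ReD (erefl _)) (big_morph _ ImD (erefl _)).
by rewrite /d /series/= !big_mkord.
Qed.

(** Connects [spec_norm] with the topology in which [mexp] takes its limit, that of the entrywise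
    maximum norm [mx_norm], whose values and radii lie in [R[i]]. *)
Lemma cvgn_spec_norm n (u : nat -> ('M[R[i]]_n : normedModType R[i])) l :
  spec_norm (u N - l) @[N --> \oo] --> (0 : R) -> u @ \oo --> l.
Proof.
move=> ul; apply/cvgrPdist_lt => e e0.
(* A positive element of [R[i]] is real, so its real part can serve as a radius in [R]. *)
have Re0 : 0 < complex.Re e by move: e0; rewrite ltcE => /andP[].
have eE : e = (complex.Re e)%:C%C by rewrite RRe_real// gtr0_real.
move/cvgrPdist_lt : ul => /(_ _ Re0); apply: filterS => N.
rewrite sub0r normrN ger0_norm ?spec_norm_ge0// => lt_e.
suff h : mx_norm (l - u N) < e by exact: h.
have [->|] := eqVneq (mx_norm (l - u N)) 0; first exact: e0.
move=> /mx_norm_neq0[[a b] /= hab]; rewrite {}hab eE.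
have := lt_e; rewrite -ltcR; apply: le_lt_trans.
suff : (normc ((l - u N) a b))%:C%C <= (spec_norm (u N - l))%:C%C.
  by move=> h; exact: h.
by rewrite lecR spec_normBC; exact: normc_le_spec_norm.
Qed.

(** Uniqueness of limits identifies [mexp A] with the entrywise limit [L A]. All later facts about
    [mexp] come from this convergence. *)
Lemma cvg_mexp n (A : 'M[R[i]]_n) :
  spec_norm (exp_sum A N - mexp A) @[N --> \oo] --> (0 : R).
Proof.
rewrite [mexp A](cvg_lim (@norm_hausdorff _ _) (cvgn_spec_norm (@exp_sum_cvgL _ A))).
exact: exp_sum_cvgL.
Qed.

End exp_partial_sums.

(** * Cauchy products of exponential series *)

Lemma sum_triangle (V : nmodType) (F : nat -> nat -> V) N :
  \sum_(m < N) \sum_(i < m.+1) F (m - i)%N i =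
  \sum_(i < N) \sum_(j < N - i) F j i.
Proof.
elim: N => [|N ih]; first by rewrite !big_ord0.
rewrite big_ord_recr/= ih [RHS]big_ord_recr/= [X in _ + X]big_ord_recr/=.
rewrite subSn// subnn big_ord1 addrA -big_split/=; congr (_ + _).
by apply: eq_bigr => i _; rewrite subSn 1?ltnW// big_ord_recr.
Qed.

(** A product of two partial sums runs over a square of indices, the partial sum of the Cauchy
    product over the triangle [i + j < N]; the pairs with [i + j >= N] are left. *)
Lemma sum_square_sub_triangle (V : zmodType) (F : nat -> nat -> V) N :
  \sum_(i < N) \sum_(j < N) F j i - \sum_(m < N) \sum_(i < m.+1) F (m - i)%N i =
  \sum_(i < N) \sum_(N - i <= j < N) F j i.
Proof.
rewrite sum_triangle -sumrB; apply: eq_bigr => i _.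
have mk m : \sum_(j < m) F j i = \sum_(0 <= j < m) F j i by rewrite big_mkord.
rewrite !mk (big_cat_nat (n := N - i)) ?leq_subr//=.
by rewrite [X in X - _]addrC addrK.
Qed.

Lemma inv_fact_bin (K : numFieldType) m i : (i <= m)%N ->
  (m`!%:R)^-1 * 'C(m, i)%:R = ((m - i)`!%:R)^-1 * (i`!%:R)^-1 :> K.
Proof.
move=> im; have f0 k : k`!%:R != 0 :> K by rewrite pnatr_eq0 -lt0n fact_gt0.
rewrite -(bin_fact im) !natrM; field.
by rewrite !f0 pnatr_eq0 -lt0n bin_gt0 im.
Qed.

Lemma exp_sumE (R : realType) n (A : 'M[R[i]]_n) N :
  exp_sum A N = \sum_(k < N) (k`!%:R)^-1 *: A ^+ k.
Proof. by []. Qed.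

(* Otherwise a failing unification unfolds limits and suprema and diverges. *)
#[local] Opaque mexp spec_norm exp_sum.

Section mexp_theory.
Context {R : realType}.
Local Open Scope classical_set_scope.

Lemma le_cvg0 (x c : R) (d : R^nat) : d @ \oo --> (0 : R) ->
  (\forall N \near \oo, x <= d N + c) -> x <= c.
Proof.
move=> d0 h; apply/ler_addgt0Pr => e e0.
move/cvgrPdist_lt : d0 => /(_ _ e0) d0.
have [N [/=]] := filter_ex (filterI h d0).
rewrite sub0r normrN => h1 h2; rewrite (le_trans h1)// addrC lerD2l.
by rewrite (le_trans (ler_norm _))// ltW.
Qed.

Lemma mexp_le n (A B : 'M[R[i]]_n) (c : R) :
  (\forall N \near \oo, spec_norm (exp_sum A N - B) <= c) ->
  spec_norm (mexp A - B) <= c.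
Proof.
move=> h; apply: (le_cvg0 (cvg_mexp A)); apply: filterS h => N h.
rewrite (le_trans (spec_norm_triangle (exp_sum A N) _ _))//.
by rewrite spec_normBC lerD2l.
Qed.

Lemma exp_coeffD (a b : R) m :
  exp_coeff (a + b) m = \sum_(i < m.+1) exp_coeff a (m - i)%N * exp_coeff b i.
Proof.
rewrite /exp_coeff/= exprDn mulr_suml; apply: eq_bigr => -[i/= im] _.
by rewrite -[(_ * _) *+ _]mulr_natr mulrACA -inv_fact_bin// [m`!%:R^-1 * _]mulrC mulrA.
Qed.

Lemma exp_termD n (A B : 'M[R[i]]_n) m : A *m B = B *m A ->
  (m`!%:R)^-1 *: (A + B) ^+ m =
  \sum_(i < m.+1) (((m - i)`!%:R)^-1 *: A ^+ (m - i)%N) *m ((i`!%:R)^-1 *: B ^+ i).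
Proof.
move=> AB; rewrite (exprDn_comm _ AB) scaler_sumr; apply: eq_bigr => -[i/= im] _.
by rewrite -[(_ * _) *+ _]scaler_nat scalerA inv_fact_bin// -scalemxAl -scalemxAr scalerA.
Qed.

(** Both differences are sums over the pairs with [i + j >= N], and their terms compare one by one;
    the matrix error is thus controlled by the same error for real exponentials. *)
Lemma spec_norm_exp_sumM n (A B : 'M[R[i]]_n) N : A *m B = B *m A ->
  spec_norm (exp_sum A N *m exp_sum B N - exp_sum (A + B) N) <=
  series (exp_coeff (spec_norm A)) N * series (exp_coeff (spec_norm B)) N -
  series (exp_coeff (spec_norm A + spec_norm B)) N.
Proof.
move=> AB.
have -> : exp_sum A N *m exp_sum B N - exp_sum (A + B) N =
    \sum_(i < N) \sum_(N - i <= j < N)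
      ((j`!%:R)^-1 *: A ^+ j) *m ((i`!%:R)^-1 *: B ^+ i).
  rewrite -(sum_square_sub_triangle
    (fun j i => ((j`!%:R)^-1 *: A ^+ j) *m ((i`!%:R)^-1 *: B ^+ i))).
  rewrite !exp_sumE mulmx_sumr; congr (_ - _); apply: eq_bigr => i _.
    by rewrite mulmx_suml.
  by rewrite exp_termD.
move: (spec_norm_exp_term A) (spec_norm_exp_term B).
move: (spec_norm A) (spec_norm B) => a b termA termB.
have seriesE (u : R^nat) : series u N = \sum_(k < N) u k by rewrite /series/= big_mkord.
have -> : series (exp_coeff a) N * series (exp_coeff b) N -
    series (exp_coeff (a + b)) N =
    \sum_(i < N) \sum_(N - i <= j < N) exp_coeff a j * exp_coeff b i.
  rewrite -(sum_square_sub_triangle (fun j i => exp_coeff a j * exp_coeff b i)).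
  rewrite 3!seriesE mulr_sumr; congr (_ - _); apply: eq_bigr => i _.
    by rewrite mulr_suml.
  by rewrite exp_coeffD.
rewrite (le_trans (spec_norm_sum _ _ _))//; apply: ler_sum => i _.
rewrite (le_trans (spec_norm_sum _ _ _))//; apply: ler_sum => j _.
rewrite (le_trans (spec_normM _ _))// ler_pM ?spec_norm_ge0//.
Qed.

(** Passing through partial sums bounds the distance of the two sides by a null sequence. Its
    essential term is [r], which tends to 0 because [expR] turns sums into products. *)
Lemma mexpD n (A B : 'M[R[i]]_n) : A *m B = B *m A ->
  mexp (A + B) = mexp A *m mexp B.
Proof.
move=> AB; apply/esym/eqP; rewrite -subr_eq0; apply/eqP/spec_norm_eq0.
pose dA N := spec_norm (exp_sum A N - mexp A).
pose dB N := spec_norm (exp_sum B N - mexp B).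
pose dAB N := spec_norm (exp_sum (A + B) N - mexp (A + B)).
pose a := spec_norm A; pose b := spec_norm B.
pose r N := series (exp_coeff a) N * series (exp_coeff b) N -
            series (exp_coeff (a + b)) N.
have r0 : r @ \oo --> (0 : R).
  rewrite -(subrr (expR a * expR b)) -{2}expRD.
  apply: cvgB; last exact: is_cvg_series_exp_coeff.
  by apply: cvgM; exact: is_cvg_series_exp_coeff.
have d0 : (dA N * spec_norm (mexp B) + expR a * dB N + r N + dAB N)
    @[N --> \oo] --> (0 : R).
  have := cvgD (cvgD (cvgD (cvgM (cvg_mexp A) (cvg_cst (spec_norm (mexp B))))
    (cvgM (cvg_cst (expR a)) (cvg_mexp B))) r0) (cvg_mexp (A + B)).
  by rewrite mul0r mulr0 !addr0; apply.
apply: (le_cvg0 d0); apply: nearW => N; rewrite addr0.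
apply: (le_trans (spec_norm_triangle (exp_sum (A + B) N) _ _)); rewrite lerD2r.
apply: (le_trans (spec_norm_triangle (exp_sum A N *m exp_sum B N) _ _)).
apply: lerD (spec_norm_exp_sumM _ AB).
apply: (le_trans (spec_norm_triangle (exp_sum A N *m mexp B) _ _)).
rewrite -mulmxBl -mulmxBr; apply: lerD.
  by rewrite /dA spec_normBC; exact: spec_normM.
rewrite /dB spec_normBC; apply: (le_trans (spec_normM _ _)).
by rewrite ler_wpM2r ?spec_norm_ge0 ?spec_norm_exp_sum.
Qed.

Lemma exp_sum_split2 n (A : 'M[R[i]]_n) N :
  exp_sum A N.+2 = 1%:M + A + \sum_(k < N) (k.+2`!%:R)^-1 *: A ^+ k.+2.
Proof.
rewrite !exp_sumE big_ord_recl big_ord_recl/= addrA; congr (_ + _ + _).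
- by rewrite fact0 invr1 scale1r expr0.
- by rewrite invr1 scale1r expr1.
Qed.

(** Keeping [h] apart from [a] makes the constant depend on [a] only. The terms with [k >= 2] are at
    most [(|h| a)^k / k!], and [|h|^k <= h^2] for [|h| <= 1]. *)
Lemma mexp_second_order n (A : 'M[R[i]]_n) (a h : R) :
  0 <= a -> `|h| <= 1 -> spec_norm A <= `|h| * a ->
  spec_norm (mexp A - (1%:M + A)) <= expR a * h ^+ 2.
Proof.
move=> a0 h1 Aa; apply: mexp_le; exists 2%N => // -[|[|N]]// _.
rewrite exp_sum_split2 [_ - _]addrC addKr.
apply: (@le_trans _ _ (series (exp_coeff a) N.+2 * h ^+ 2)); last first.
  by rewrite ler_wpM2r ?sqr_ge0 ?series_exp_coeff_le.
(* The first two terms of the majorant are nonnegative and have no counterpart on the left. *)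
rewrite /series/= big_mkord big_ord_recl big_ord_recl/= addrA mulrDl.
apply: ler_wpDl.
  by rewrite mulr_ge0 ?sqr_ge0// addr_ge0// exp_coeff_ge0.
rewrite mulr_suml (le_trans (spec_norm_sum _ _ _))//; apply: ler_sum => k _.
apply: (le_trans (spec_norm_exp_term _ _)).
have ecE (x : R) m : exp_coeff x m = x ^+ m / m`!%:R by [].
rewrite /bump !leq0n !add1n !ecE [in leRHS]mulrAC ler_wpM2r ?invr_ge0//.
apply: (@le_trans _ _ ((`|h| * a) ^+ k.+2)).
  by rewrite lerXn2r ?nnegrE ?spec_norm_ge0 ?mulr_ge0.
rewrite exprMn mulrC ler_wpM2l ?exprn_ge0// -[h ^+ 2]real_normK ?num_real//.
by rewrite -addn2 exprD ler_piMl ?sqr_ge0// exprn_ile1.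
Qed.

Lemma mexp0 n : mexp (0 : 'M[R[i]]_n) = 1%:M.
Proof.
apply/eqP; rewrite -subr_eq0; apply/eqP/spec_norm_eq0.
have := @mexp_second_order n 0 0 0 (lexx _).
have -> : 1%:M + 0 = 1%:M :> 'M[R[i]]_n by exact: addr0.
by rewrite normr0 mul0r expr0n mulr0; apply; rewrite ?spec_norm0.
Qed.

(** * Adjoints and unitary matrices *)

Definition adjmx n (A : 'M[R[i]]_n) : 'M[R[i]]_n := map_mx conjc A^T.

Lemma adjmxB n (A B : 'M[R[i]]_n) : adjmx (A - B) = adjmx A - adjmx B.
Proof. by apply/matrixP => i j; rewrite !mxE rmorphB. Qed.

Lemma adjmxX n (A : 'M[R[i]]_n) k : adjmx (A ^+ k) = adjmx A ^+ k.
Proof.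
elim: k => [|k ih].
  by apply/matrixP => i j; rewrite !mxE rmorph_nat eq_sym.
by rewrite exprSr exprS -ih /adjmx trmx_mul map_mxM.
Qed.

Lemma adjmx_exp_sum n (A : 'M[R[i]]_n) N :
  adjmx (exp_sum A N) = exp_sum (adjmx A) N.
Proof.
apply/matrixP => i j; rewrite !exp_sumE !mxE !summxE rmorph_sum/=; apply: eq_bigr => k _.
by rewrite -adjmxX !mxE rmorphM fmorphV rmorph_nat.
Qed.

(** Crude but sufficient: the bound only has to carry a null sequence through the adjoint, so the
    dimension factor is harmless. *)
Lemma spec_norm_adjmx n (A : 'M[R[i]]_n) :
  spec_norm (adjmx A) <= (n * n)%:R * spec_norm A.
Proof.
rewrite (le_trans (spec_norm_le_sum _))//.
apply: (@le_trans _ _ (\sum_(i < n) \sum_(j < n) spec_norm A)).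
  apply: ler_sum => i _; apply: ler_sum => j _; rewrite !mxE.
  apply: le_trans (normc_le_spec_norm A j i).
  by case: (A j i) => a b /=; rewrite sqrrN.
by rewrite !sumr_const !card_ord -mulrnA mulr_natl.
Qed.

Lemma mexp_adjmx n (A : 'M[R[i]]_n) : mexp (adjmx A) = adjmx (mexp A).
Proof.
apply/eqP; rewrite -subr_eq0; apply/eqP/spec_norm_eq0.
pose dA N := spec_norm (exp_sum A N - mexp A).
pose dB N := spec_norm (exp_sum (adjmx A) N - mexp (adjmx A)).
have d0 : (dB N + (n * n)%:R * dA N) @[N --> \oo] --> (0 : R).
  have := cvgD (cvg_mexp (adjmx A)) (cvgM (cvg_cst ((n * n)%:R : R)) (cvg_mexp A)).
  by rewrite mulr0 addr0; apply.
apply: (le_cvg0 d0); apply: nearW => N; rewrite addr0.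
rewrite (le_trans (spec_norm_triangle (exp_sum (adjmx A) N) _ _))//.
by rewrite spec_normBC lerD2l -adjmx_exp_sum -adjmxB spec_norm_adjmx.
Qed.

(** The squared Euclidean norm is [v^* v], and the hypothesis says that [U] preserves it. *)
Lemma spec_norm_unitary n (U : 'M[R[i]]_n) : adjmx U *m U = 1%:M -> spec_norm U <= 1.
Proof.
move=> UU; apply: spec_norm_le => // v; rewrite mul1r.
have sqE (w : 'cV[R[i]]_n) : (vnorm w ^+ 2)%:C%C = (map_mx conjc w^T *m w) 0 0.
  rewrite vnorm_sqr rmorph_sum mxE; apply: eq_bigr => i _; rewrite !mxE.
  case: (w i 0) => a b /=; rewrite sqr_sqrtr ?addr_ge0 ?sqr_ge0//.
  by congr Complex; ring.
rewrite -(ler_pXn2r (ltn0Sn 1)) ?nnegrE ?vnorm_ge0// -lecR !sqE.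
rewrite trmx_mul map_mxM mulmxA -[_ *m _ *m U]mulmxA.
by rewrite [map_mx _ U^T *m U]UU mulmx1.
Qed.

End mexp_theory.

(** * Unitary evolution and the interaction picture *)

Section evolution.
Context {R : realType}.
Implicit Types (s t h : R).

Local Notation mi h := (- ('i * (h%:C)%C)).

Lemma normc_Ni h : normc (mi h) = `|h|.
Proof. by rewrite normcN normcM normc_imaginary mul1r normc_real. Qed.

Lemma spec_norm_NiZ n h (A : 'M[R[i]]_n) :
  spec_norm (mi h *: A) <= `|h| * spec_norm A.
Proof. by rewrite -normc_Ni spec_normZ. Qed.

Lemma evolE n t (H : 'M[R[i]]_n) : evol t H = mexp (mi t *: H).
Proof. by []. Qed.

Lemma evol0 n (H : 'M[R[i]]_n) : evol 0 H = 1%:M.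
Proof. by rewrite evolE rmorph0 mulr0 oppr0 scale0r mexp0. Qed.

Lemma evolD n s t (H : 'M[R[i]]_n) : evol (s + t) H = evol s H *m evol t H.
Proof.
rewrite 3!evolE -mexpD; first by rewrite -scalerDl -opprD -mulrDr -rmorphD.
by rewrite -scalemxAl -scalemxAr -[RHS]scalemxAl -[in RHS]scalemxAr !scalerA [in RHS]mulrC.
Qed.

Lemma evolVK n t (H : 'M[R[i]]_n) : evol (- t) H *m evol t H = 1%:M.
Proof. by rewrite -evolD addNr evol0. Qed.

Lemma evolKV n t (H : 'M[R[i]]_n) : evol t H *m evol (- t) H = 1%:M.
Proof. by rewrite -evolD subrr evol0. Qed.

(** For Hermitian [H] the adjoint of [-itH] is [itH], so the adjoint of [evol t H] is its inverse
    [evol (- t) H]. *)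
Lemma spec_norm_evol n t (H : 'M[R[i]]_n) :
  is_hermitian H -> spec_norm (evol t H) <= 1.
Proof.
move=> hH; apply: spec_norm_unitary.
suff -> : adjmx (evol t H) = evol (- t) H by exact: evolVK.
rewrite !evolE -mexp_adjmx; congr mexp.
rewrite -[in RHS]hH; apply/matrixP => j k; rewrite !mxE rmorphM; congr (_ * _).
by rewrite -complexiE; apply/eqP; rewrite eq_complex/=; apply/andP; split; apply/eqP; ring.
Qed.

Lemma evol_second_order n h (H : 'M[R[i]]_n) : `|h| <= 1 ->
  spec_norm (evol h H - (1%:M + mi h *: H)) <= expR (spec_norm H) * h ^+ 2.
Proof.
by move=> h1; apply: mexp_second_order => //; rewrite ?spec_norm_ge0 ?spec_norm_NiZ.
Qed.

End evolution.

#[local] Opaque evol.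

(** * The interaction picture and its expansion over a short time *)

Section interaction_picture.
Context {R : realType}.
Implicit Types (s t h : R).

Local Notation mi h := (- ('i * (h%:C)%C)).

Lemma ler_sqr_norm h : `|h| <= 1 -> h ^+ 2 <= `|h|.
Proof. by move=> h1; rewrite -real_normK ?num_real// expr2 ler_piMl. Qed.

Lemma evol_taylor n (H : 'M[R[i]]_n) : exists2 K : R, 0 <= K &
  forall h, `|h| <= 1 -> spec_norm (evol h H - 1%:M) <= K * `|h| /\
    spec_norm (evol h H - (1%:M + mi h *: H)) <= K * h ^+ 2.
Proof.
have E0 : 0 <= expR (spec_norm H) by exact: expR_ge0.
have := spec_norm_ge0 H => N0.
exists (expR (spec_norm H) + spec_norm H); first exact: addr_ge0.
move=> h h1; have h2 := evol_second_order H h1; split; last first.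
  by apply: (le_trans h2); rewrite ler_wpM2r ?sqr_ge0// lerDl.
apply: (le_trans (spec_norm_triangle (1%:M + mi h *: H) _ _)).
rewrite mulrDl; apply: lerD.
  by apply: (le_trans h2); rewrite ler_wpM2l// ler_sqr_norm.
rewrite [X in spec_norm X]addrC addKr [leRHS]mulrC; exact: spec_norm_NiZ.
Qed.

Lemma spec_normM_le1 n (A B : 'M[R[i]]_n) c :
  spec_norm A <= 1 -> spec_norm B <= c -> spec_norm (A *m B) <= c.
Proof.
move=> A1 Bc; apply: (le_trans (spec_normM _ _)); rewrite -[c]mul1r.
by rewrite ler_pM ?spec_norm_ge0.
Qed.

Lemma spec_normMr_le1 n (A B : 'M[R[i]]_n) c :
  spec_norm B <= 1 -> spec_norm A <= c -> spec_norm (A *m B) <= c.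
Proof.
move=> B1 Ac; apply: (le_trans (spec_normM _ _)); rewrite -[c]mulr1.
by rewrite ler_pM ?spec_norm_ge0.
Qed.

(** The operator [A_B(t)]; each factor of the product in [Uapx] is one of these, with [B] a single
    [H1 g]. *)
Definition interaction n (H0 B : 'M[R[i]]_n) (alpha t : R) :=
  evol (- t) H0 *m evol t (H0 + alpha%:C%C *: B).

(** The unitary [Q] of the factorisation: interaction over a time [h], moved to time [s] by
    conjugation with the free evolution. *)
Definition interaction_step n (H0 B : 'M[R[i]]_n) (alpha s h : R) :=
  evol (- s) H0 *m interaction H0 B alpha h *m evol s H0.

(** Both exponentials are split at [s]; between the two factors on the right stands
    [e^{-isH0} e^{isH0} = 1]. *)
Lemma interactionD n (H0 B : 'M[R[i]]_n) alpha s h :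
  interaction H0 B alpha (s + h) =
  interaction_step H0 B alpha s h *m interaction H0 B alpha s.
Proof.
rewrite /interaction_step /interaction.
rewrite opprD.
rewrite (evolD (- s)).
rewrite (addrC s h).
rewrite (evolD h s).
move: (evol (- s) H0) (evol s H0) (evolKV s H0) => X Y XY.
rewrite -!mulmxA; congr (_ *m (_ *m (_ *m _))).
by rewrite mulmxA XY mul1mx.
Qed.

Lemma interactionE n (H0 B : 'M[R[i]]_n) alpha t :
  interaction H0 B alpha t = evol (- t) H0 *m evol t (H0 + alpha%:C%C *: B).
Proof. by []. Qed.

Lemma interaction0 n (H0 B : 'M[R[i]]_n) alpha : interaction H0 B alpha 0 = 1%:M.
Proof. by rewrite /interaction oppr0 !evol0 mulmx1. Qed.

Lemma hermitianD n (A B : 'M[R[i]]_n) :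
  is_hermitian A -> is_hermitian B -> is_hermitian (A + B).
Proof. by move=> hA hB; rewrite /is_hermitian linearD/= map_mxD hA hB. Qed.

Lemma hermitianZ n alpha (B : 'M[R[i]]_n) :
  is_hermitian B -> is_hermitian (alpha%:C%C *: B).
Proof.
move=> hB; rewrite /is_hermitian -[in RHS]hB; apply/matrixP => j k.
by rewrite !mxE rmorphM; congr (_ * _); exact: conjc_real.
Qed.

Lemma spec_norm_interaction n (H0 B : 'M[R[i]]_n) alpha t :
  is_hermitian H0 -> is_hermitian B -> spec_norm (interaction H0 B alpha t) <= 1.
Proof.
move=> h0 hB; apply: spec_normM_le1; first exact: spec_norm_evol.
by apply: spec_norm_evol; apply: hermitianD => //; exact: hermitianZ.
Qed.

Lemma spec_norm_interaction_step n (H0 B : 'M[R[i]]_n) alpha s h :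
  is_hermitian H0 -> is_hermitian B ->
  spec_norm (interaction_step H0 B alpha s h) <= 1.
Proof.
move=> h0 hB; apply: spec_normMr_le1; first exact: spec_norm_evol.
by apply: spec_normM_le1; [exact: spec_norm_evol|exact: spec_norm_interaction].
Qed.

(** With [x] and [y] the first-order parts coming from [H0] and [alpha B], the two factors are
    [1 - x] and [1 + x + y] up to [O(h^2)]; the [x] cancel and leave [1 + y]. *)
Lemma interaction_second_order n (H0 B : 'M[R[i]]_n) alpha : is_hermitian H0 ->
  exists2 K : R, 0 <= K & forall h, `|h| <= 1 ->
  spec_norm (interaction H0 B alpha h - (1%:M + mi h *: (alpha%:C%C *: B)))
    <= K * h ^+ 2.
Proof.
move=> h0; pose H := H0 + alpha%:C%C *: B.
have [K0 K0_ge0 hK0] := evol_taylor H0; have [K1 K1_ge0 hK1] := evol_taylor H.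
have N_ge0 := spec_norm_ge0 H.
exists (K1 + (K0 + K0 * spec_norm H)); first by rewrite !(addr_ge0, mulr_ge0).
move=> h h1; rewrite /interaction -/H.
have hN1 : `|- h| <= 1 by rewrite normrN.
have [hP1 hP2] := hK0 _ hN1; have [_ hQ] := hK1 _ h1.
have hH : spec_norm (mi h *: H) <= spec_norm H * `|h|.
  rewrite [leRHS]mulrC; exact: spec_norm_NiZ.
have e0 : mi (- h) *: H0 = - (mi h *: H0) by rewrite rmorphN mulrN scaleNr.
have eH : mi h *: H = mi h *: H0 + mi h *: (alpha%:C%C *: B).
  exact: scalerDr.
rewrite normrN in hP1; rewrite sqrrN e0 in hP2.
have P1 : spec_norm (evol (- h) H0) <= 1 by exact: spec_norm_evol.
rewrite eH in hH; rewrite eH in hQ.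
move: hP1 hP2 hQ hH P1 {N_ge0}; move: (spec_norm H) => N.
move: (evol (- h) H0) (evol h H) (mi h *: H0) (mi h *: (_ *: B)) => P Q x y.
move=> hP1 hP2 hQ hxy P1.
apply: (le_trans (spec_norm_triangle (P *m (1%:M + (x + y))) _ _)).
rewrite -mulmxBr mulrDl; apply: lerD; first exact: spec_normM_le1.
(* The first summand is a second-order remainder, the second a product of two first-order
   quantities. *)
have -> : P *m (1%:M + (x + y)) - (1%:M + y) =
    (P - (1%:M - x)) + (P - 1%:M) *m (x + y).
  rewrite mulmxDr mulmx1 mulmxBl mul1mx; move: (P *m (x + y)) => u.
  by apply/matrixP => a b; rewrite !mxE; ring.
apply: (le_trans (spec_normD _ _)); rewrite mulrDl; apply: lerD => //.
apply: (le_trans (spec_normM _ _)).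
rewrite -[h ^+ 2]real_normK ?num_real// expr2 mulrACA.
by apply: ler_pM => //; exact: spec_norm_ge0.
Qed.

(** Conjugation by the free evolution turns [B] into [heis H0 B s] and does not increase the norm of
    the remainder, so [K] is uniform in [s]. *)
Lemma interaction_step_second_order n (H0 B : 'M[R[i]]_n) alpha : is_hermitian H0 ->
  exists2 K : R, 0 <= K & forall s h, `|h| <= 1 ->
  spec_norm (interaction_step H0 B alpha s h -
     (1%:M + mi h *: (alpha%:C%C *: heis H0 B s))) <= K * h ^+ 2.
Proof.
move=> h0; have [K K0 hK] := interaction_second_order B alpha h0.
exists K; first exact: K0.
move=> s h h1; have {}hK := hK h h1.
have -> : interaction_step H0 B alpha s h -
    (1%:M + mi h *: (alpha%:C%C *: heis H0 B s)) = evol (- s) H0 *m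
    (interaction H0 B alpha h - (1%:M + mi h *: (alpha%:C%C *: B))) *m evol s H0.
  rewrite mulmxBr mulmxBl; congr (_ - _).
  rewrite mulmxDr mulmx1 mulmxDl evolVK; congr (_ + _).
  by rewrite /heis -!(scalemxAr, scalemxAl).
apply: spec_normMr_le1; first exact: spec_norm_evol.
by apply: spec_normM_le1 => //; exact: spec_norm_evol.
Qed.

Lemma spec_norm_heis n (H0 B : 'M[R[i]]_n) s : is_hermitian H0 ->
  spec_norm (heis H0 B s) <= spec_norm B.
Proof.
move=> h0; apply: spec_normMr_le1; first exact: spec_norm_evol.
by apply: spec_normM_le1 => //; exact: spec_norm_evol.
Qed.

Lemma heisD n (H0 B : 'M[R[i]]_n) s h :
  heis H0 B (s + h) = evol (- h) H0 *m heis H0 B s *m evol h H0.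
Proof. by rewrite /heis opprD evolD [- s - h]addrC evolD !mulmxA. Qed.

Lemma heis_add n (H0 B C : 'M[R[i]]_n) s : heis H0 (B + C) s = heis H0 B s + heis H0 C s.
Proof. by rewrite /heis mulmxDr mulmxDl. Qed.

Lemma heis_sum n (I : finType) (H0 : 'M[R[i]]_n) (B : I -> 'M[R[i]]_n) s :
  heis H0 (\sum_i B i) s = \sum_i heis H0 (B i) s.
Proof. by rewrite /heis mulmx_sumr mulmx_suml. Qed.

(** For distances at most 1, the first-order estimate is applied on both sides of the conjugation
    and gives [2 * k * b]; larger distances use the trivial bound [2 * b]. The constant adds the
    two. *)
Lemma heis_lipschitz n (H0 B : 'M[R[i]]_n) : is_hermitian H0 ->
  exists2 K : R, 0 <= K & forall s t,
  spec_norm (heis H0 B s - heis H0 B t) <= K * `|s - t|.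
Proof.
move=> h0; pose b := spec_norm B.
have [k k0 hk] := evol_taylor H0.
have b0 : 0 <= b by exact: spec_norm_ge0.
exists (2 * k * b + 2 * b); first by rewrite addr_ge0// !mulr_ge0.
move=> s t; have [h1|h1] := leP `|s - t| 1; last first.
  apply: (@le_trans _ _ (2 * b)).
    apply: (le_trans (spec_normB _ _)); rewrite mulr_natl mulr2n.
    by rewrite lerD ?spec_norm_heis.
  rewrite [leRHS]mulrDl ler_wpDl ?mulr_ge0//.
  by rewrite ler_peMr ?mulr_ge0// ltW.
rewrite -{1}[s](subrK t) [s - t + t]addrC heisD; move: (s - t) h1 => h h1.
set X := heis H0 B t; have Xb : spec_norm X <= b by exact: spec_norm_heis.
apply: (le_trans (spec_norm_triangle (X *m evol h H0) _ _)).
have -> : evol (- h) H0 *m X *m evol h H0 - X *m evol h H0 =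
    (evol (- h) H0 - 1%:M) *m X *m evol h H0 by rewrite !mulmxBl mul1mx.
have -> : X *m evol h H0 - X = X *m (evol h H0 - 1%:M) by rewrite mulmxBr mulmx1.
have -> : (2 * k * b + 2 * b) * `|h| = (k * `|- h| * b) + (b * (k * `|h|)) + 2 * b * `|h|.
  by rewrite normrN; ring.
rewrite ler_wpDr ?mulr_ge0// lerD//.
  apply: spec_normMr_le1; first exact: spec_norm_evol.
  apply: (le_trans (spec_normM _ _)); apply: ler_pM Xb; try exact: spec_norm_ge0.
  by apply: (proj1 (hk _ _)); rewrite normrN.
apply: (le_trans (spec_normM _ _)); apply: ler_pM Xb _; try exact: spec_norm_ge0.
by case: (hk h h1).
Qed.

End interaction_picture.

(** * Integrating growth rates *)

Section integrals.
Context {R : realType}.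
Implicit Types (f g : R -> R) (a b c t L K M : R).
Local Open Scope classical_set_scope.
Local Notation mu := (@lebesgue_measure R).

Lemma lipschitz_integrable g a b L :
  (forall x y, a <= x <= b -> a <= y <= b -> `|g x - g y| <= L * `|x - y|) ->
  mu.-integrable `[a, b] (EFin \o g).
Proof.
move=> gL; apply: continuous_compact_integrable; first exact: segment_compact.
apply/subspace_continuousP => x /=; rewrite in_itv/= => xab.
apply/cvgrPdist_lt => e e0; apply/nbhs_ballP.
(* The absolute value and the [+ 1] keep the radius positive whatever the value of [L]. *)
exists (e / (`|L| + 1)) => /=; first by rewrite divr_gt0// ltr_wpDl.
move=> y /= xy; rewrite in_itv/= => yab.
apply: (le_lt_trans (gL _ _ xab yab)); move: xy; rewrite /ball/=.
rewrite ltr_pdivlMr ?ltr_wpDl// mulrC; apply: le_lt_trans.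
by rewrite ler_wpM2r// (le_trans (ler_norm _))// lerDl.
Qed.

(** The Boolean chooses a closed or an open left end, so that the same estimates serve [[a, b]] and
    the half-open pieces []a, b]] of a subdivision. *)
Lemma measure_itvR (x : bool) a b : a <= b ->
  fine (mu [set` Interval (BSide x a) (BRight b)]) = b - a.
Proof.
move=> ab; rewrite lebesgue_measure_itv/= lte_fin.
by case: ltgtP ab => //= -> _; rewrite subrr.
Qed.

Lemma integrable_cst_itv (x : bool) a b c :
  mu.-integrable [set` Interval (BSide x a) (BRight b)] (EFin \o cst c).
Proof.
have ic : mu.-integrable `[a, b] (EFin \o cst c).
  by apply: (@lipschitz_integrable _ _ _ 0) => *; rewrite subrr normr0 mul0r.
apply: integrableS ic => //.
by apply: subset_itvr; case: x; rewrite bnd_simp.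
Qed.

Lemma Rintegral_le_cst (x : bool) g a b c : a <= b ->
  mu.-integrable [set` Interval (BSide x a) (BRight b)] (EFin \o g) ->
  (forall y, a <= y <= b -> g y <= c) ->
  \int[mu]_(y in [set` Interval (BSide x a) (BRight b)]) g y <= c * (b - a).
Proof.
move=> ab ig gc; rewrite -(measure_itvR x ab) -Rintegral_cst//.
apply: le_Rintegral => //; first exact: integrable_cst_itv.
move=> y /= yab; apply: gc; move: yab; rewrite in_itv/=.
by case: x {ig} => //= /andP[/ltW -> ->].
Qed.

Lemma Rintegral_ge_cst (x : bool) g a b c : a <= b ->
  mu.-integrable [set` Interval (BSide x a) (BRight b)] (EFin \o g) ->
  (forall y, a <= y <= b -> c <= g y) ->
  c * (b - a) <= \int[mu]_(y in [set` Interval (BSide x a) (BRight b)]) g y.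
Proof.
move=> ab ig gc; rewrite -(measure_itvR x ab) -Rintegral_cst//.
apply: le_Rintegral => //; first exact: integrable_cst_itv.
move=> y /= yab; apply: gc; move: yab; rewrite in_itv/=.
by case: x {ig} => //= /andP[/ltW -> ->].
Qed.

Lemma Rintegral_split g a b c : a <= b -> b <= c ->
  mu.-integrable `[a, c] (EFin \o g) ->
  \int[mu]_(y in `[a, c]) g y =
  \int[mu]_(y in `[a, b]) g y + \int[mu]_(y in `]b, c]) g y.
Proof.
move=> ab bc ig; rewrite -(@Rintegral_itvB _ g (BLeft a) (BRight c) b) ?bnd_simp//.
by rewrite addrC subrK.
Qed.

(* Subdividing [0, t] into N pieces, the quadratic errors add up to O(1/N). *)
Lemma growth_le_integral (p g : R -> R) t L C : 0 <= t -> 0 <= L ->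
  (forall x y, 0 <= x <= t -> 0 <= y <= t -> `|g x - g y| <= L * `|x - y|) ->
  (forall a h, 0 <= a -> 0 <= h <= 1 -> a + h <= t ->
    p (a + h) <= p a + g a * h + C * h ^+ 2) ->
  p t <= p 0 + \int[mu]_(x in `[0, t]) g x.
Proof.
move=> t0 L0 gL pg.
have d0 : ((C + L) * t ^+ 2 * N.+1%:R^-1) @[N --> \oo] --> (0 : R).
  have := cvgM (cvg_cst ((C + L) * t ^+ 2)) (@cvg_harmonic R).
  by rewrite mulr0; apply.
apply: (le_cvg0 d0); near=> N.
(* Makes the step [h = t / (N + 1)] at most 1, the range in which the growth hypothesis applies. *)
have tN : t <= N%:R by near: N; exact: nbhs_infty_ger.
pose h := t / N.+1%:R.
have h0 : 0 <= h by rewrite divr_ge0.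
have h1 : h <= 1 by rewrite ler_pdivrMr// mul1r (le_trans tN)// ler_nat.
have Nh : N.+1%:R * h = t by rewrite mulrC divfK.
(* Each piece costs [(C + L) * h ^+ 2]: [C] comes from the growth hypothesis, [L] from replacing
   [g a * h] by the integral of [g] over the piece. *)
have step k : (k <= N.+1)%N -> p (k%:R * h) <=
    p 0 + \int[mu]_(x in `[0, k%:R * h]) g x + k%:R * ((C + L) * h ^+ 2).
  elim: k => [|k ih kN].
    by rewrite !mul0r addr0 set_itv1 Rintegral_set1 addr0.
  have {ih} := ih (ltnW kN).
  have -> : k.+1%:R * h = k%:R * h + h by rewrite -natr1 mulrDl mul1r.
  have : k%:R * h + h <= t.
    by rewrite -Nh -[X in _ + X]mul1r -mulrDl natr1 ler_wpM2r// ler_nat.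
  have : 0 <= k%:R * h by rewrite mulr_ge0.
  move: (k%:R * h) => a a0 aht ih.
  have ig : mu.-integrable `[0, a + h] (EFin \o g).
    by apply: (@lipschitz_integrable _ _ _ L) => x y /andP[? ?] /andP[? ?];
      apply: gL; apply/andP; split => //; exact: le_trans aht.
  rewrite (@Rintegral_split _ _ a) ?lerDl//.
  have low : (g a - L * h) * h <= \int[mu]_(x in `]a, a + h]) g x.
    have {2}-> : h = a + h - a by rewrite addrC addrA addNr add0r.
    apply: Rintegral_ge_cst; first by rewrite lerDl.
      apply: integrableS ig => //; apply: subset_itvr.
      by rewrite bnd_simp.
    move=> y /andP[ay yh]; rewrite lerBlDr -lerBlDl (le_trans (ler_norm _))//.
    apply: (le_trans (gL _ _ _ _)).
    - by rewrite a0/= (le_trans _ aht)// lerDl.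
    - by rewrite (le_trans a0 ay) (le_trans yh).
    - by rewrite ler_wpM2l// distrC ger0_norm ?subr_ge0// lerBlDl.
  have := pg a h a0; rewrite h0 h1 => /(_ isT aht) pa.
  apply: (le_trans pa); rewrite -natr1 mulrDl mul1r.
  move: ih low; set I1 := Rintegral _ _ _; set I2 := Rintegral _ _ _; set J := _%:R * _.
  by move=> ih low; lra.
have := step _ (leqnn _); rewrite Nh => /le_trans; apply.
(* The [N + 1] equal errors sum to [(C + L) t^2 / (N + 1)]. *)
rewrite [leRHS]addrC lerD2l [leLHS](_ : _ = (C + L) * t ^+ 2 / N.+1%:R)//.
have q0 : N.+1%:R != 0 :> R by rewrite pnatr_eq0.
by rewrite /h; move: (N.+1%:R) q0 => q q0; field.
Unshelve. all: by end_near. Qed.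

(** A class of kernels closed under sums on which both integrals of [double_integral] exist. The
    bounds control a moving upper limit; the joint Lipschitz condition gives integrability. *)
Definition lip_bounded (f : R -> R -> R) := exists2 K : R, 0 <= K &
  (forall s v, 0 <= f s v <= K) /\
  (forall s v s' v', `|f s v - f s' v'| <= K * (`|s - s'| + `|v - v'|)).

Definition double_integral (f : R -> R -> R) t :=
  \int[mu]_(v in `[0, t]) \int[mu]_(s in `[0, v]) f s v.

Implicit Type F : R -> R -> R.

Lemma lip_bounded_integrable F v a b : lip_bounded F ->
  mu.-integrable `[a, b] (EFin \o F ^~ v).
Proof.
move=> [K K0 [_ FL]]; apply: (@lipschitz_integrable _ _ _ K) => x y _ _.
by rewrite (le_trans (FL _ _ _ _))// subrr normr0 addr0.
Qed.

(** Moving [v] changes the integrand, over a length at most [t], and the upper limit, where the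
    integrand is at most [K]; hence [K * t + K]. The inner integral thereby becomes an admissible
    rate for [growth_le_integral]. *)
Lemma inner_integral_lipschitz F t : lip_bounded F -> 0 <= t ->
  exists2 L, 0 <= L & forall v w, 0 <= v <= t -> 0 <= w <= t ->
  `|\int[mu]_(s in `[0, v]) F s v - \int[mu]_(s in `[0, w]) F s w|
    <= L * `|v - w|.
Proof.
move=> FLB t0; have [K K0 [Fb FL]] := FLB.
exists (K * t + K); first by rewrite addr_ge0// mulr_ge0.
suff h v w : 0 <= v -> v <= w -> w <= t ->
    `|\int[mu]_(s in `[0, v]) F s v - \int[mu]_(s in `[0, w]) F s w|
    <= (K * t + K) * `|v - w|.
  move=> v w /andP[v0 vt] /andP[w0 wt]; have [vw|/ltW wv] := leP v w.
    exact: h.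
  by rewrite distrC (distrC v); exact: h.
move=> v0 vw wt.
have int x a b := @lip_bounded_integrable F x a b FLB.
rewrite (@Rintegral_split (F ^~ w) _ v)// opprD addrA.
rewrite -RintegralB//; apply: (le_trans (ler_normB _ _)); rewrite mulrDl lerD//.
  have iB : mu.-integrable `[0, v] (EFin \o (fun s => F s v - F s w)).
    apply: (@lipschitz_integrable _ _ _ (K + K)) => x y _ _.
    have -> : F x v - F x w - (F y v - F y w) = (F x v - F y v) - (F x w - F y w).
      by ring.
    rewrite (le_trans (ler_normB _ _))// mulrDl lerD//.
      by rewrite (le_trans (FL _ _ _ _))// subrr normr0 addr0.
    by rewrite (le_trans (FL _ _ _ _))// subrr normr0 addr0.
  apply: (@le_trans _ _ (K * `|v - w| * v)); last first.
    by rewrite mulrAC ler_wpM2r// ler_wpM2l// (le_trans vw).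
  have hb s : `|F s v - F s w| <= K * `|v - w|.
    by rewrite (le_trans (FL _ _ _ _))// subrr normr0 add0r.
  rewrite -[X in _ * X]subr0 ler_norml -mulNr; apply/andP; split.
    by apply: Rintegral_ge_cst => // s _; have := hb s; rewrite ler_norml => /andP[].
  by apply: Rintegral_le_cst => // s _; have := hb s; rewrite ler_norml => /andP[].
rewrite ger0_norm; last first.
  by apply: Rintegral_ge0 => s _; case/andP: (Fb s w).
rewrite distrC (@ger0_norm _ (w - v)) ?subr_ge0//.
apply: Rintegral_le_cst => //.
  by apply: integrableS (int w v w) => //; apply: subset_itvr; rewrite bnd_simp.
by move=> s _; case/andP: (Fb s w).
Qed.

Lemma inner_integral_integrable F t : lip_bounded F -> 0 <= t ->
  mu.-integrable `[0, t] (EFin \o (fun v => \int[mu]_(s in `[0, v]) F s v)).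
Proof.
move=> FLB t0; have [L _ hL] := inner_integral_lipschitz FLB t0.
exact: lipschitz_integrable hL.
Qed.

Lemma double_integral_le F F' t : lip_bounded F -> lip_bounded F' -> 0 <= t ->
  (forall s v, F s v <= F' s v) -> double_integral F t <= double_integral F' t.
Proof.
move=> FLB FLB' t0 FF'; apply: le_Rintegral => //.
- exact: inner_integral_integrable.
- exact: inner_integral_integrable.
- move=> v _; apply: le_Rintegral => //.
  + exact: lip_bounded_integrable.
  + exact: lip_bounded_integrable.
Qed.

Lemma double_integralD F F' t : lip_bounded F -> lip_bounded F' -> 0 <= t ->
  double_integral (fun s v => F s v + F' s v) t =
  double_integral F t + double_integral F' t.
Proof.
move=> FLB FLB' t0; rewrite /double_integral -RintegralD//.
- apply: eq_Rintegral => v _; rewrite RintegralD//.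
  + exact: lip_bounded_integrable.
  + exact: lip_bounded_integrable.
- exact: inner_integral_integrable.
- exact: inner_integral_integrable.
Qed.

Lemma double_integral_ge0 F t : (forall s v, 0 <= F s v) -> 0 <= double_integral F t.
Proof. by move=> F0; do 2 (apply: Rintegral_ge0 => ? _). Qed.

(** The inner integral is at most [K * v <= K * t], and the outer one has length [t]. This is the
    source of the [t^2] in the short-time estimate. *)
Lemma double_integral_upper F : lip_bounded F ->
  exists K, forall t, 0 <= t -> double_integral F t <= K * t ^+ 2.
Proof.
move=> FLB; have [K K0 [Fb _]] := FLB; exists K => t t0.
rewrite expr2 mulrA -[X in _ * X]subr0; apply: Rintegral_le_cst => //.
  exact: inner_integral_integrable.
move=> v /andP[v0 vt]; apply: (@le_trans _ _ (K * v)); last by rewrite ler_wpM2l.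
rewrite -[v in leRHS]subr0; apply: Rintegral_le_cst => //.
  exact: lip_bounded_integrable.
by move=> s _; case/andP: (Fb s v).
Qed.

Lemma lip_boundedD F F' : lip_bounded F -> lip_bounded F' ->
  lip_bounded (fun s v => F s v + F' s v).
Proof.
move=> [K K0 [Fb FL]] [K' K'0 [Fb' FL']]; exists (K + K'); first exact: addr_ge0.
split=> [s v|s v s' v'].
  have /andP[? ?] := Fb s v; have /andP[? ?] := Fb' s v.
  by rewrite addr_ge0//= lerD.
rewrite opprD addrACA mulrDl (le_trans (ler_normD _ _))// lerD//.
Qed.

Lemma lip_bounded0 : lip_bounded (fun _ _ => 0).
Proof. by exists 0 => //; split=> *; rewrite ?lexx// subrr normr0 mul0r. Qed.

Lemma lip_bounded_sum (I : Type) (r : seq I) (P : pred I) (F : I -> R -> R -> R) :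
  (forall i, lip_bounded (F i)) ->
  lip_bounded (fun s v => \sum_(i <- r | P i) F i s v).
Proof.
move=> FLB; elim: r => [|i r ih].
  rewrite (_ : (fun _ _ => _) = fun _ _ => 0); first exact: lip_bounded0.
  by apply/funext => s; apply/funext => v; rewrite big_nil.
rewrite (_ : (fun _ _ => _) = fun s v =>
    (if P i then F i s v else 0) + \sum_(j <- r | P j) F j s v).
  apply: (@lip_boundedD (fun s v => if P i then F i s v else 0) _ _ ih).
  by case: (P i); [exact: FLB|exact: lip_bounded0].
by apply/funext => s; apply/funext => v; rewrite big_cons; case: ifP; rewrite ?add0r.
Qed.

End integrals.

(** * The splitting error *)

#[local] Opaque heis interaction interaction_step.

(** * Commutator identities and norm estimates *)

Section commutators.
Context {R : realType}.

Lemma spec_norm_comm n (A B : 'M[R[i]]_n) :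
  spec_norm (comm A B) <= 2 * (spec_norm A * spec_norm B).
Proof.
rewrite mulr_natl mulr2n; apply: (le_trans (spec_normB _ _)); apply: lerD.
  exact: spec_normM.
by rewrite [leRHS]mulrC; exact: spec_normM.
Qed.

Lemma commBl n (A A' B : 'M[R[i]]_n) : comm (A - A') B = comm A B - comm A' B.
Proof.
rewrite /comm mulmxBl mulmxBr.
move: (A *m B) (A' *m B) (B *m A) (B *m A') => a b c d.
by apply/matrixP => j k; rewrite !mxE; ring.
Qed.

Lemma commBr n (A B B' : 'M[R[i]]_n) : comm A (B - B') = comm A B - comm A B'.
Proof.
rewrite /comm mulmxBl mulmxBr.
move: (A *m B) (A *m B') (B *m A) (B' *m A) => a b c d.
by apply/matrixP => j k; rewrite !mxE; ring.
Qed.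

Lemma commZl n c (A B : 'M[R[i]]_n) : comm (c *: A) B = c *: comm A B.
Proof. by rewrite /comm -scalemxAl -scalemxAr scalerBr. Qed.

Lemma commZr n c (A B : 'M[R[i]]_n) : comm A (c *: B) = c *: comm A B.
Proof. by rewrite /comm -scalemxAl -scalemxAr scalerBr. Qed.

Lemma comm1l n (B : 'M[R[i]]_n) : comm 1%:M B = 0.
Proof. by rewrite /comm mul1mx mulmx1 subrr. Qed.

Lemma comm1Dl n (A B : 'M[R[i]]_n) : comm (1%:M + A) B = comm A B.
Proof. by rewrite /comm mulmxDl mulmxDr mul1mx mulmx1 opprD addrACA subrr add0r. Qed.

Lemma comm_suml n (I : finType) (A : I -> 'M[R[i]]_n) B :
  comm (\sum_j A j) B = \sum_j comm (A j) B.
Proof. by rewrite /comm mulmx_suml mulmx_sumr -sumrB. Qed.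

Lemma commMl n (A B C : 'M[R[i]]_n) :
  comm (A *m B) C = A *m comm B C + comm A C *m B.
Proof.
rewrite /comm mulmxBr mulmxBl !mulmxA.
move: (A *m B *m C) (A *m C *m B) (C *m A *m B) => a b c.
by apply/matrixP => j k; rewrite !mxE; ring.
Qed.

(** In use, [QB], [QC] and [QW] are close to [1 + yB], [1 + yC] and [1 + yB + yC]. To first order
    the terms [A] and [yB *m A] cancel, and [yC *m A - A *m yC] survives. *)
Lemma split_step_le n (A QW QB QC yB yC : 'M[R[i]]_n) :
  spec_norm A <= 1 -> spec_norm QB <= 1 ->
  spec_norm (QW *m A - QB *m A *m QC) <= spec_norm (comm A yC) +
    (spec_norm (QW - (1%:M + (yB + yC))) + spec_norm (QB - (1%:M + yB)) +
     spec_norm (QC - (1%:M + yC)) + spec_norm (QB - 1%:M) * spec_norm yC).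
Proof.
move=> A1 QB1.
(* Three corrections replace a factor by its first-order form; the last one removes [QB] from in
   front of [A *m yC]. *)
have -> : QW *m A - QB *m A *m QC = - comm A yC +
    ((QW - (1%:M + (yB + yC))) *m A - (QB - (1%:M + yB)) *m A -
     QB *m A *m (QC - (1%:M + yC)) - (QB - 1%:M) *m A *m yC).
  rewrite /comm !(mulmxBl, mulmxBr, mulmxDl, mulmxDr, mul1mx, mulmx1).
  move: (QW *m A) (QB *m A) (A *m yC) (yC *m A) (yB *m A) => a1 a2 a3 a4 a5.
  move: (a2 *m QC) (a2 *m yC) => a6 a7.
  by apply/matrixP => j k; rewrite !mxE; ring.
apply: (le_trans (spec_normD _ _)); rewrite spec_normN lerD2l.
apply: (le_trans (spec_normB _ _)); apply: lerD; last first.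
  apply: (le_trans (spec_normM _ _)); apply: ler_wpM2r; first exact: spec_norm_ge0.
  exact: (spec_normMr_le1 A1 (lexx _)).
apply: (le_trans (spec_normB _ _)); apply: lerD; last first.
  exact: (spec_normM_le1 (spec_normM_le1 QB1 A1) (lexx _)).
apply: (le_trans (spec_normB _ _)).
exact: (lerD (spec_normMr_le1 A1 (lexx _)) (spec_normMr_le1 A1 (lexx _))).
Qed.

(** Changing one argument at a time; this is the source of the Lipschitz bounds for the commutator
    norms integrated below. *)
Lemma spec_norm_comm_dist n (A A' B B' : 'M[R[i]]_n) :
  `|spec_norm (comm A B) - spec_norm (comm A' B')| <=
  2 * (spec_norm (A - A') * spec_norm B) + 2 * (spec_norm A' * spec_norm (B - B')).
Proof.
apply: (le_trans (spec_norm_dist _ _)).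
apply: (le_trans (spec_norm_triangle (comm A' B) _ _)).
by rewrite -commBl -commBr; apply: lerD; exact: spec_norm_comm.
Qed.

End commutators.

#[local] Opaque comm.

(** * Growth of the error and induction on the number of summands *)

Section splitting_error.
Context {R : realType}.
Implicit Types (s t h alpha : R).

Local Notation mi h := (- ('i * (h%:C)%C)).
Local Notation mu := (@lebesgue_measure R).
Local Open Scope classical_set_scope.

Definition comm_heis n (H0 B C : 'M[R[i]]_n) s t :=
  spec_norm (comm (heis H0 B s) (heis H0 C t)).

Lemma lip_bounded_comm_heis n (H0 B C : 'M[R[i]]_n) : is_hermitian H0 ->
  lip_bounded (comm_heis H0 B C).
Proof.
move=> h0; have [KB KB0 hB] := heis_lipschitz B h0.
have [KC KC0 hC] := heis_lipschitz C h0.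
have nB s := spec_norm_heis B s h0; have nC s := spec_norm_heis C s h0.
have B0 := spec_norm_ge0 B; have C0 := spec_norm_ge0 C.
move: (spec_norm B) (spec_norm C) nB nC B0 C0 => b c nB nC b0 c0.
have kb0 : 0 <= KB * c by exact: mulr_ge0.
have kc0 : 0 <= b * KC by exact: mulr_ge0.
have bc0 : 0 <= b * c by exact: mulr_ge0.
(* The first two terms are the Lipschitz constants in [s] and in [v], the third is the uniform
   bound; the sum serves all requirements. *)
exists (2 * (KB * c) + 2 * (b * KC) + 2 * (b * c)); first lra.
rewrite /comm_heis; split=> [s v|s v s' v'].
  rewrite spec_norm_ge0/=; apply: (le_trans (spec_norm_comm _ _)).
  apply: (@le_trans _ _ (2 * (b * c))); last by rewrite lerDr addr_ge0// mulr_ge0.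
  rewrite ler_pM2l ?ltr0n//; apply: ler_pM.
  - exact: spec_norm_ge0.
  - exact: spec_norm_ge0.
  - exact: nB.
  - exact: nC.
apply: (le_trans (spec_norm_comm_dist _ _ _ _)).
apply: (@le_trans _ _ (2 * (KB * `|s - s'| * c) + 2 * (b * (KC * `|v - v'|)))).
  apply: lerD; rewrite ler_pM2l ?ltr0n//; apply: ler_pM.
  - exact: spec_norm_ge0.
  - exact: spec_norm_ge0.
  - exact: hB.
  - exact: nC.
  - exact: spec_norm_ge0.
  - exact: spec_norm_ge0.
  - exact: nB.
  - exact: hC.
move: (normr_ge0 (s - s')) (normr_ge0 (v - v')) => {hB hC nB nC}.
move: `|s - s'| `|v - v'| => x y x0 y0.
have p1 : 0 <= KB * c * y by exact: mulr_ge0.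
have p2 : 0 <= b * KC * x by exact: mulr_ge0.
have p3 : 0 <= b * c * (x + y) by rewrite mulr_ge0// addr_ge0.
lra.
Qed.

(* Duhamel estimate: A_B(s + h) = Q A_B(s) with Q = 1 - i h alpha B(s) + O(h^2), and
   [Q A, X] = Q [A, X] + [Q, X] A with Q and A unitary. *)
Lemma comm_interaction_le n (H0 B X : 'M[R[i]]_n) alpha t :
  is_hermitian H0 -> is_hermitian B -> 0 <= t ->
  spec_norm (comm (interaction H0 B alpha t) X) <=
  `|alpha| * \int[mu]_(s in `[0, t]) spec_norm (comm (heis H0 B s) X).
Proof.
move=> h0 hB t0; have [L L0 hL] := heis_lipschitz B h0.
have [K K0 hK] := interaction_step_second_order B alpha h0.
have X0 := spec_norm_ge0 X.
have gL x y : `|spec_norm (comm (heis H0 B x) X) - spec_norm (comm (heis H0 B y) X)|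
    <= 2 * (L * spec_norm X) * `|x - y|.
  apply: (le_trans (spec_norm_comm_dist _ _ _ _)).
  have -> : spec_norm (X - X) = 0 by rewrite subrr spec_norm0.
  move: (hL x y) (spec_norm (heis H0 B y)) X0.
  move: (spec_norm (_ - _)) (spec_norm X) => d c hd e c0.
  by rewrite !mulr0 addr0 -mulrA ler_pM2l ?ltr0n// mulrAC ler_wpM2r.
rewrite -RintegralZl//; last first.
  by apply: (@lipschitz_integrable _ _ _ _ (2 * (L * spec_norm X))) => x y _ _; exact: gL.
have p0 : spec_norm (comm (interaction H0 B alpha 0) X) = 0.
  by rewrite interaction0 comm1l spec_norm0.
rewrite -[leRHS]add0r -{1}p0.
(* The first constant is the Lipschitz constant of the rate; the second bounds the commutator of [X]
   with the remainder of [Q]. *)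
apply: (@growth_le_integral _ (fun s => spec_norm (comm (interaction H0 B alpha s) X)) _ _
  (`|alpha| * (2 * (L * spec_norm X))) (2 * (K * spec_norm X))) => //.
- by rewrite !mulr_ge0.
- move=> x y _ _; rewrite -mulrBr normrM normr_id -mulrA ler_wpM2l//.
- move=> a h a0 /andP[h_ge0 h1] _; rewrite interactionD.
have hn1 : `|h| <= 1 by rewrite ger0_norm.
have hQ := hK a h hn1.
have Q1 : spec_norm (interaction_step H0 B alpha a h) <= 1.
  exact: spec_norm_interaction_step.
have A1 : spec_norm (interaction H0 B alpha a) <= 1 by exact: spec_norm_interaction.
move: (interaction_step H0 B alpha a h) (interaction H0 B alpha a) (heis H0 B a) hQ Q1 A1.
move=> Q A D hQ Q1 A1.
rewrite commMl.
apply: (le_trans (spec_normD _ _)); rewrite -addrA; apply: lerD.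
  exact: (spec_normM_le1 Q1 (lexx _)).
apply: (spec_normMr_le1 A1).
(* The identity part of [Q] commutes with [X]; the term linear in [h] gives the rate and the
   remainder gives the quadratic error. *)
have -> : comm Q X = comm (Q - (1%:M + mi h *: (alpha%:C%C *: D))) X +
    mi h *: (alpha%:C%C *: comm D X).
  by rewrite commBl comm1Dl !commZl subrK.
apply: (le_trans (spec_normD _ _)); rewrite [leLHS]addrC; apply: lerD.
  apply: (le_trans (spec_norm_NiZ _ _)).
  rewrite (ger0_norm h_ge0) [leLHS]mulrC; apply: ler_wpM2r; first exact: h_ge0.
  by apply: (le_trans (spec_normZ _ _)); rewrite normc_real; exact: lexx.
apply: (le_trans (spec_norm_comm _ _)).
rewrite -mulrA ler_pM2l ?ltr0n// mulrAC; apply: ler_wpM2r; first exact: X0.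
exact: hQ.
Qed.

(** One time step adds a splitting error whose linear part is governed by [[A_B(a), C(a)]].
    [comm_interaction_le] with [X = heis H0 C a] bounds it by the inner integral, and
    [growth_le_integral] supplies the outer one. *)
Lemma interaction_split_le n (H0 B C : 'M[R[i]]_n) alpha t :
  is_hermitian H0 -> is_hermitian B -> is_hermitian C -> 0 <= t ->
  spec_norm (interaction H0 (B + C) alpha t -
             interaction H0 B alpha t *m interaction H0 C alpha t)
    <= alpha ^+ 2 * double_integral (comm_heis H0 B C) t.
Proof.
move=> h0 hB hC t0.
have hBC : is_hermitian (B + C) by exact: hermitianD.
have FLB := lip_bounded_comm_heis B C h0.
have [L L0 hL] := inner_integral_lipschitz FLB t0.
have [KW KW0 hW] := interaction_step_second_order (B + C) alpha h0.
have [KB KB0 hKB] := interaction_step_second_order B alpha h0.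
have [KC KC0 hKC] := interaction_step_second_order C alpha h0.
rewrite /double_integral -RintegralZl//; last exact: inner_integral_integrable.
have p0 : spec_norm (interaction H0 (B + C) alpha 0 -
    interaction H0 B alpha 0 *m interaction H0 C alpha 0) = 0.
  by rewrite !interaction0 mulmx1 subrr spec_norm0.
rewrite -[leRHS]add0r -{1}p0.
have b0 := spec_norm_ge0 B; have c0 := spec_norm_ge0 C.
have nB s := spec_norm_heis B s h0; have nC s := spec_norm_heis C s h0.
move: (spec_norm B) (spec_norm C) b0 c0 nB nC => b c b0 c0 nB nC.
(* In the quadratic constant, [KW], [KB] and [KC] stand for the three remainders; the product bounds
   [||QB - 1|| ||yC||], where each factor is of order [h]. *)
apply: (@growth_le_integral _ (fun s => spec_norm (interaction H0 (B + C) alpha s -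
    interaction H0 B alpha s *m interaction H0 C alpha s)) _ _
  (alpha ^+ 2 * L)
  (KW + KB + KC + (KB + `|alpha| * b) * (`|alpha| * c))) => //.
- by rewrite mulr_ge0 ?sqr_ge0.
- move=> x y xt yt; rewrite -mulrBr normrM ger0_norm ?sqr_ge0// -mulrA.
  by rewrite ler_wpM2l ?sqr_ge0// hL.
- move=> a h a0 /andP[h_ge0 h1] _; rewrite !interactionD.
have hn1 : `|h| <= 1 by rewrite ger0_norm.
have {hW} := hW a h hn1; have {hKB} := hKB a h hn1; have {hKC} := hKC a h hn1.
rewrite heis_add 2!scalerDr.
have hcomm := comm_interaction_le (heis H0 C a) alpha h0 hB a0.
have W1 : spec_norm (interaction_step H0 (B + C) alpha a h) <= 1.
  exact: spec_norm_interaction_step.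
have B1 : spec_norm (interaction_step H0 B alpha a h) <= 1.
  exact: spec_norm_interaction_step.
have I1 : spec_norm (interaction H0 B alpha a) <= 1 by exact: spec_norm_interaction.
have J1 : spec_norm (interaction H0 C alpha a) <= 1 by exact: spec_norm_interaction.
have yBle : spec_norm (mi h *: (alpha%:C%C *: heis H0 B a)) <= h * (`|alpha| * b).
  apply: (le_trans (spec_norm_NiZ _ _)).
  rewrite (ger0_norm h_ge0); apply: ler_wpM2l; first exact: h_ge0.
  apply: (le_trans (spec_normZ _ _)); rewrite normc_real.
  by apply: ler_wpM2l.
have yCle : spec_norm (mi h *: (alpha%:C%C *: heis H0 C a)) <= h * (`|alpha| * c).
  apply: (le_trans (spec_norm_NiZ _ _)).
  rewrite (ger0_norm h_ge0); apply: ler_wpM2l; first exact: h_ge0.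
  apply: (le_trans (spec_normZ _ _)); rewrite normc_real.
  by apply: ler_wpM2l.
have cle : spec_norm (comm (interaction H0 B alpha a) (mi h *: (alpha%:C%C *: heis H0 C a)))
    <= alpha ^+ 2 * (\int[mu]_(s in `[0, a]) comm_heis H0 B C s a) * h.
  rewrite !commZr; apply: (le_trans (spec_norm_NiZ _ _)).
  rewrite (ger0_norm h_ge0) [leLHS]mulrC; apply: ler_wpM2r; first exact: h_ge0.
  apply: (le_trans (spec_normZ _ _)); rewrite normc_real.
  rewrite -[alpha ^+ 2]real_normK ?num_real// expr2 -mulrA.
  by apply: ler_wpM2l; [exact: normr_ge0|exact: hcomm].
move: yBle yCle cle {hcomm}.
move: (alpha%:C%C *: heis H0 B a) => yB0; move: (mi h *: yB0) => {yB0} yB.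
move: (alpha%:C%C *: heis H0 C a) => yC0; move: (mi h *: yC0) => {yC0} yC.
move: (alpha ^+ 2 * _) => G yBle yCle cle.
move: (interaction_step H0 (B + C) alpha a h) W1 => QW W1.
move: (interaction_step H0 B alpha a h) B1 => QB B1.
move: (interaction_step H0 C alpha a h) => QC.
move: (interaction H0 (B + C) alpha a) => W.
move: (interaction H0 B alpha a) I1 cle => A A1 cle.
move: (interaction H0 C alpha a) J1 => J J1.
move=> hC2 hB2 hW2.
have QB1 : spec_norm (QB - 1%:M) <= h * (KB + `|alpha| * b).
  apply: (le_trans (spec_norm_triangle (1%:M + yB) _ _)).
  rewrite mulrDr; apply: lerD.
    apply: (le_trans hB2); rewrite [leLHS]mulrC; apply: ler_wpM2r; first exact: KB0.
    by rewrite expr2 -[leRHS]mulr1; apply: ler_wpM2l.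
  by rewrite [X in spec_norm X]addrC addKr.
have QByC : spec_norm (QB - 1%:M) * spec_norm yC <=
    h * (KB + `|alpha| * b) * (h * (`|alpha| * c)).
  by apply: ler_pM; [exact: spec_norm_ge0|exact: spec_norm_ge0|exact: QB1|exact: yCle].
(* Separates the error inherited from time [a] from the one made in this step. *)
have -> : QW *m W - QB *m A *m (QC *m J) =
    QW *m (W - A *m J) + (QW *m A - QB *m A *m QC) *m J.
  by rewrite mulmxBr mulmxBl !mulmxA addrA subrK.
apply: (le_trans (spec_normD _ _)); rewrite -addrA; apply: lerD.
  exact: (spec_normM_le1 W1 (lexx _)).
apply: (spec_normMr_le1 J1).
apply: (le_trans (split_step_le QW QC yB yC A1 B1)); apply: lerD => //.
have -> : (KW + KB + KC + (KB + `|alpha| * b) * (`|alpha| * c)) * h ^+ 2 =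
  KW * h ^+ 2 + KB * h ^+ 2 + KC * h ^+ 2 +
  h * (KB + `|alpha| * b) * (h * (`|alpha| * c)) by ring.
by apply: lerD => //; apply: lerD => //; exact: lerD.
Qed.

Lemma hermitian_sum n (I : finType) (B : I -> 'M[R[i]]_n) :
  (forall j, is_hermitian (B j)) -> is_hermitian (\sum_j B j).
Proof.
move=> hB; elim/big_ind: _ => //; last by move=> x y; exact: hermitianD.
by rewrite /is_hermitian trmx0 map_mx0.
Qed.

Lemma lip_bounded_comm_sum n Gamma (H0 : 'M[R[i]]_n) (H1 : 'I_Gamma -> 'M[R[i]]_n) :
  is_hermitian H0 -> lip_bounded (comm_sum H0 H1).
Proof.
move=> h0; rewrite /comm_sum; apply: lip_bounded_sum => g1.
by apply: lip_bounded_sum => g2; exact: lip_bounded_comm_heis.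
Qed.

(** Pairs [g1 < g2] are sorted by whether [g2] is the last index; [g1] never is. *)
Lemma comm_sumS n Gamma (H0 : 'M[R[i]]_n) (H1 : 'I_Gamma.+1 -> 'M[R[i]]_n) s v :
  comm_sum H0 H1 s v =
  comm_sum H0 (fun g : 'I_Gamma => H1 (widen_ord (leqnSn Gamma) g)) s v +
  \sum_(g < Gamma) comm_heis H0 (H1 (widen_ord (leqnSn Gamma) g)) (H1 ord_max) s v.
Proof.
rewrite /comm_sum big_ord_recr/= [X in _ + X]big1 ?addr0 => [|g]; last first.
  by rewrite ltnNge -ltnS ltn_ord.
rewrite -big_split/=; apply: eq_bigr => g _.
by rewrite big_mkcond big_ord_recr/= ltn_ord -big_mkcond.
Qed.

Lemma Uexact_interaction n Gamma (H0 : 'M[R[i]]_n) (H1 : 'I_Gamma -> 'M[R[i]]_n) alpha t :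
  Uexact H0 H1 alpha t = evol t H0 *m interaction H0 (\sum_g H1 g) alpha t.
Proof. by rewrite interactionE mulmxA evolKV mul1mx. Qed.

(** Induction on [Gamma]: [B] is the sum of all summands but the last, [C] the last one. The
    induction hypothesis pays for splitting [B], and [interaction_split_le] for separating [C] from
    it. *)
Lemma Uexact_Uapx_le n Gamma (H0 : 'M[R[i]]_n) (H1 : 'I_Gamma -> 'M[R[i]]_n) alpha t :
  is_hermitian H0 -> (forall g, is_hermitian (H1 g)) -> 0 <= t ->
  spec_norm (Uexact H0 H1 alpha t - Uapx H0 H1 alpha t)
    <= alpha ^+ 2 * double_integral (comm_sum H0 H1) t.
Proof.
move=> h0 + t0; elim: Gamma H1 => [|Gamma ih] H1 hH1.
  (* Without summands both operators are the free evolution, and the bound only has to be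
     nonnegative. *)
  rewrite /Uexact /Uapx !big_ord0 scaler0 addr0.
  have -> : evol t H0 *m 1 = evol t H0 by exact: mulmx1.
  rewrite subrr spec_norm0 mulr_ge0 ?sqr_ge0// double_integral_ge0// => s v.
  by do 2 (apply: sumr_ge0 => ? _); exact: spec_norm_ge0.
pose H1' (g : 'I_Gamma) := H1 (widen_ord (leqnSn Gamma) g).
have hH1' g : is_hermitian (H1' g) by exact: hH1.
have {ih} := ih H1' hH1'; set C := H1 ord_max.
have hC : is_hermitian C by exact: hH1.
have -> : Uapx H0 H1 alpha t = Uapx H0 H1' alpha t *m interaction H0 C alpha t.
  by rewrite /Uapx big_ord_recr/= -mulmxA interactionE.
rewrite !Uexact_interaction big_ord_recr/= -/C.
have hB := hermitian_sum hH1'.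
rewrite -[\sum_(i < Gamma) H1 _]/(\sum_(g < Gamma) H1' g).
have hsplit := interaction_split_le alpha h0 hB hC t0.
have I1 := spec_norm_interaction alpha t h0 hC.
have E1 := spec_norm_evol t h0.
have LB g : lip_bounded (comm_heis H0 (H1' g) C) by exact: lip_bounded_comm_heis.
have LS : lip_bounded (fun s v => \sum_(g < Gamma) comm_heis H0 (H1' g) C s v).
  exact: lip_bounded_sum.
(* Additivity of the commutator and the triangle inequality produce exactly the pairs whose second
   index is the last one. *)
have : double_integral (comm_heis H0 (\sum_g H1' g) C) t <=
    double_integral (fun s v => \sum_(g < Gamma) comm_heis H0 (H1' g) C s v) t.
  apply: double_integral_le => //; first exact: lip_bounded_comm_heis.
  by move=> s v; rewrite /comm_heis heis_sum comm_suml spec_norm_sum.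
have -> : comm_sum H0 H1 = fun s v => comm_sum H0 H1' s v +
    \sum_(g < Gamma) comm_heis H0 (H1' g) C s v.
  by apply/funext => s; apply/funext => v; exact: comm_sumS.
rewrite (double_integralD (lip_bounded_comm_sum H1' h0) LS t0).
move: hsplit; set D := double_integral (comm_heis _ _ _) t.
move: (double_integral _ t) (double_integral _ t) => D1 D2.
move: (\sum_g H1' g) hB I1 E1 => B hB.
move: (interaction H0 C alpha t) (evol t H0) (interaction H0 (B + C) alpha t).
move=> J E W; move: (interaction H0 B alpha t) (Uapx H0 H1' alpha t) => A V J1 E1.
move=> hW hD hV.
(* The first term is the splitting of [C], the second the induction hypothesis; the outer factors
   [E] and [J] have norm at most 1. *)
have -> : E *m W - V *m J = E *m (W - A *m J) + (E *m A - V) *m J.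
  by rewrite mulmxBr mulmxBl !mulmxA addrA subrK.
apply: (le_trans (spec_normD _ _)); rewrite mulrDr [leLHS]addrC; apply: lerD.
  exact: (spec_normMr_le1 J1 hV).
apply: (spec_normM_le1 E1); apply: (le_trans hW).
by apply: ler_wpM2l hD; exact: sqr_ge0.
Qed.

End splitting_error.

Theorem theorem1 (R : realType) (n Gamma : nat) (H0 : 'M[complex R]_n)
    (H1 : 'I_Gamma -> 'M[complex R]_n) :
  is_hermitian H0 -> (forall g, is_hermitian (H1 g)) ->
  (forall (alpha t : R), 0 <= t ->
     spec_norm (Uexact H0 H1 alpha t - Uapx H0 H1 alpha t)
       <= alpha ^+ 2 * err_bound_integral H0 H1 t) /\
  (exists (K delta : R), 0 < delta /\
     forall (alpha t : R), 0 <= t <= delta ->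
       spec_norm (Uexact H0 H1 alpha t - Uapx H0 H1 alpha t)
         <= K * alpha ^+ 2 * t ^+ 2).
Proof.
move=> h0 hH1; split; first by move=> alpha t; exact: Uexact_Uapx_le.
have [K hK] := double_integral_upper (lip_bounded_comm_sum H1 h0).
(* [K] comes from [comm_sum], which does not involve [alpha], so it is uniform in [alpha]. It bounds
   the integral at all nonnegative times, and [delta = 1] is a convenient choice. *)
exists K, 1; split => // alpha t /andP[t0 _].
apply: (le_trans (Uexact_Uapx_le alpha h0 hH1 t0)).
rewrite -mulrA mulrCA; apply: ler_wpM2l; first exact: sqr_ge0.
exact: hK.
Qed.
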